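(* Let $\mu_0,\mu_1$ be finite nonnegative Borel measures on $\mathbb R^d$, and let $(\varphi_0,\varphi_1)$ be a tight optimal pair of potentials for $(\mu_0,\mu_1)$. Set $\xi_0:=\frac12(e^{2\varphi_0}-1)$, $\bar\xi_1:=\frac12(1-e^{-2\varphi_1})$, $\xi_t:=\mathscr P_t\xi_0$, $\bar\xi_t:=\mathscr R_{1-t}\bar\xi_1$ and $\Xi_t:=\{\xi_t=\bar\xi_t\}$ for $t\in[0,1]$. Let $(\mu_t)_{t\in[0,1]}$ be an arbitrary $\mathsf{HK}$ geodesic connecting $\mu_0$ to $\mu_1$. Then: (1) For all $s,t\in[0,1]$ with $s<t$, both pairs $(\xi_s,\xi_t)$ and $(\bar\xi_s,\bar\xi_t)$ are optimal dual pairs connecting $\mu_s$ to $\mu_t$: with $\tau=t-s$ they satisfy the constraint $$(1-2\tau\xi_t(x))(1+2\tau\xi_s(y))\ge\cos^2(\min\{|x-y|,\tfrac\pi2\})\quad\text{whenever }\xi_s(y)<\infty,\ \xi_t(x)>-\infty$$ (and the same for $(\bar\xi_s,\bar\xi_t)$), and $$\frac1{2(t-s)}\mathsf{HK}^2(\mu_s,\mu_t)=\int\xi_t\,\mathrm d\mu_t-\int\xi_s\,\mathrm d\mu_s=\int\bar\xi_t\,\mathrm d\mu_t-\int\bar\xi_s\,\mathrm d\mu_s .$$ (2) $\operatorname{supp}(\mu_t)\subset\Xi_t$ for every $t\in[0,1]$.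
   Context: $\mathsf{HK}(\mu_0,\mu_1)^2=\min_{\boldsymbol\eta}\{\int F(\sigma_0)\mathrm d\mu_0+\int F(\sigma_1)\mathrm d\mu_1+\iint 2\mathrm L_1(x_0-x_1)\mathrm d\boldsymbol\eta\}$, where $\boldsymbol\eta$ ranges over finite nonnegative Borel measures on $\mathbb R^d\times\mathbb R^d$ with marginals $\sigma_i\mu_i$, $F(s)=s\log s-s+1$, $F(0)=1$, $\mathrm L_1(z)=-\log\cos|z|$ for $|z|<\pi/2$ and $+\infty$ otherwise. A geodesic is a curve $(\mu_t)_{t\in[0,1]}$ of finite nonnegative Borel measures with $\mathsf{HK}(\mu_s,\mu_t)=|s-t|\,\mathsf{HK}(\mu_0,\mu_1)$ for all $s,t\in[0,1]$. Tight optimal pair for $(\mu_0,\mu_1)$: $\varphi_0,\varphi_1:\mathbb R^d\to[-\infty,+\infty]$, $\varphi_0$ l.s.c., $\varphi_1$ u.s.c., with $\varphi_0(x_0)=\sup_{|x_1-x_0|<\pi/2}\varphi_1(x_1)-\mathrm L_1(x_1-x_0)$ and $\varphi_1(x_1)=\inf_{|x_0-x_1|<\pi/2}\varphi_0(x_0)+\mathrm L_1(x_1-x_0)$ on $\mathbb R^d$, $\int e^{2\varphi_0}\mathrm d\mu_0<\infty$, $\int e^{-2\varphi_1}\mathrm d\mu_1<\infty$, and $\frac12\mathsf{HK}(\mu_0,\mu_1)^2=\int\frac12(1-e^{-2\varphi_1})\mathrm d\mu_1-\int\frac12(e^{2\varphi_0}-1)\mathrm d\mu_0$. Generalized Hopf--Lax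 operators: for $t\in(0,1]$, $$(\mathscr P_t\xi)(x)=\inf_{|y-x|<\pi/2}\frac1{2t}\Big(1-\frac{\cos^2(|x-y|)}{1+2t\xi(y)}\Big),\qquad \mathscr R_t\bar\xi:=-\mathscr P_t(-\bar\xi),$$ with the conventions $c/0=+\infty$, $c/(+\infty)=0$ for $c>0$; $\mathscr P_0,\mathscr R_0$ are the identity. *)

(* Defs.v *)
From HB Require Import structures.
From mathcomp Require Import all_boot all_order all_algebra.
From mathcomp Require Import all_classical all_reals all_analysis.

Set Implicit Arguments.
Unset Strict Implicit.
Unset Printing Implicit Defensive.

Import Order.TTheory GRing.Theory Num.Theory.
Import numFieldNormedType.Exports.

Local Open Scope classical_set_scope.
Local Open Scope ring_scope.

(* R^d with its Borel sigma-algebra; convertible to ['rV[R]_d]. *)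
Notation borelRd R d := (g_sigma_algebraType (@open 'rV[R]_d)).

Section HellingerKantorovich.
Context {R : realType} {d : nat}.
Local Notation V := 'rV[R]_d.
Local Notation T := (borelRd R d).
Local Notation fmeas := {finite_measure set T -> \bar R}.

(* The library norm on ['rV[R]_d] is the sup norm, hence this definition. *)
Definition enorm (z : V) : R := Num.sqrt (\sum_(i < d) z ord0 i ^+ 2).

Definition entropyF (s : R) : R := if s == 0 then 1 else s * ln s - s + 1.

Definition L1 (z : V) : \bar R :=
  if enorm z < pi / 2 then (- ln (cos (enorm z)))%:E else +oo%E.

Local Open Scope ereal_scope.

(* [eta] has marginals [s0 mu0] and [s1 mu1]. *)
Definition has_marginals (mu0 mu1 : fmeas)
    (eta : {finite_measure set (T * T)%type -> \bar R}) (s0 s1 : T -> R) :=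
  [/\ measurable_fun setT s0 /\ measurable_fun setT s1,
      (forall x, 0 <= s0 x)%R /\ (forall x, 0 <= s1 x)%R,
      forall A : set T, measurable A ->
        pushforward eta fst A = \int[mu0]_(x in A) (s0 x)%:E &
      forall A : set T, measurable A ->
        pushforward eta snd A = \int[mu1]_(x in A) (s1 x)%:E].

Definition HK_cost (mu0 mu1 : fmeas)
    (eta : {finite_measure set (T * T)%type -> \bar R}) (s0 s1 : T -> R) : \bar R :=
  \int[mu0]_x (entropyF (s0 x))%:E + \int[mu1]_x (entropyF (s1 x))%:E
  + \int[eta]_p (2%:E * L1 ((p.1 : V) - (p.2 : V))%R).

(* The infimum is attained, and it is finite: [eta = 0] costs
   [mu0 setT + mu1 setT]. *)
Definition HK (mu0 mu1 : fmeas) : \bar R :=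
  sqrte (ereal_inf [set c | exists eta s0 s1,
    has_marginals mu0 mu1 eta s0 s1 /\ c = HK_cost mu0 mu1 eta s0 s1]).

Definition HK_geodesic (mu : R -> fmeas) :=
  forall s t : R, (0 <= s <= 1)%R -> (0 <= t <= 1)%R ->
    HK (mu s) (mu t) = `|s - t|%:E * HK (mu 0%R) (mu 1%R).

(* Two measures are identified when they agree on the measurable sets; the
   library leaves their values on other sets unconstrained. *)
Definition connects (mu : R -> fmeas) (mu0 mu1 : fmeas) :=
  forall A : set T, measurable A -> mu 0%R A = mu0 A /\ mu 1%R A = mu1 A.

(* Mirrors the library's [lower_semicontinuous]. *)
Definition upper_semicontinuous (f : V -> \bar R) :=
  forall x a, f x < a%:E ->
    exists2 U, nbhs x U & forall y, U y -> f y < a%:E.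

Definition xi0 (phi0 : V -> \bar R) : V -> \bar R :=
  fun x => 2^-1%:E * (expeR (2%:E * phi0 x) - 1).

Definition bxi1 (phi1 : V -> \bar R) : V -> \bar R :=
  fun x => 2^-1%:E * (1 - expeR (- (2%:E * phi1 x))).

Record tight_optimal_pair (mu0 mu1 : fmeas) (phi0 phi1 : V -> \bar R) : Prop :=
  TightOptimalPair {
  tight_lsc : lower_semicontinuous phi0;
  tight_usc : upper_semicontinuous phi1;
  tight_sup : forall x0, phi0 x0 =
    ereal_sup [set phi1 x1 - L1 (x1 - x0)%R
              | x1 in [set x1 | enorm (x1 - x0) < pi / 2]%R];
  tight_inf : forall x1, phi1 x1 =
    ereal_inf [set phi0 x0 + L1 (x1 - x0)%R
              | x0 in [set x0 | enorm (x0 - x1) < pi / 2]%R];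
  tight_fin0 : \int[mu0]_x expeR (2%:E * phi0 x) < +oo;
  tight_fin1 : \int[mu1]_x expeR (- (2%:E * phi1 x)) < +oo;
  tight_optimal : 2^-1%:E * HK mu0 mu1 ^+ 2 =
    \int[mu1]_x bxi1 phi1 x - \int[mu0]_x xi0 phi0 x
  }.

(* For [c > 0] the library's division satisfies [c%:E / 0 = +oo] and
   [c%:E / +oo = 0]. *)
Definition hopf_laxP (t : R) (xi : V -> \bar R) : V -> \bar R :=
  fun x => if t == 0%R then xi x else
    ereal_inf [set (2 * t)^-1%:E *
                   (1 - (cos (enorm (x - y)) ^+ 2)%:E
                        / (1 + (2 * t)%:E * xi y))
              | y in [set y | enorm (y - x) < pi / 2]%R].

Definition hopf_laxR (t : R) (bxi : V -> \bar R) : V -> \bar R :=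
  \- hopf_laxP t (\- bxi).

Definition xi_ (phi0 : V -> \bar R) (t : R) : V -> \bar R :=
  hopf_laxP t (xi0 phi0).

Definition bxi_ (phi1 : V -> \bar R) (t : R) : V -> \bar R :=
  hopf_laxR (1 - t) (bxi1 phi1).

Definition contact_set (phi0 phi1 : V -> \bar R) (t : R) : set V :=
  [set x | xi_ phi0 t x = bxi_ phi1 t x].

Definition dual_constraint (tau : R) (xs xt : V -> \bar R) :=
  forall x y : V, xs y < +oo -> -oo < xt x ->
    (cos (Num.min (enorm (x - y)) (pi / 2)) ^+ 2)%:E <=
    (1 - (2 * tau)%:E * xt x) * (1 + (2 * tau)%:E * xs y).

(* As the left-hand side of the equality is finite, both integrals are. *)
Definition optimal_dual_pair (tau : R) (mus mut : fmeas)
    (xs xt : V -> \bar R) :=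
  dual_constraint tau xs xt /\
  (2 * tau)^-1%:E * HK mus mut ^+ 2 = \int[mut]_x xt x - \int[mus]_x xs x.

Definition supp (mu : fmeas) : set V :=
  [set x | forall U : set V, open U -> U x -> 0 < mu U].

End HellingerKantorovich.

(* Main.v *)
Require Import Defs.
From HB Require Import structures.
From mathcomp Require Import all_boot all_order all_algebra.
From mathcomp Require Import all_classical all_reals all_analysis.
From mathcomp Require Import measurable_realfun ring lra.

(** The proof squeezes a chain of weak duality inequalities between its ends.

    Weak duality ([weak_duality], [dual_pair_le]): if [xs], [xt] satisfy the dual
    constraint with step [tau], then [int xt dmut - int xs dmus] is at most
    [(2 * tau)^-1 * HK mus mut ^+ 2].  With [a = 1 + 2 * tau * xs] and
    [b = 1 - 2 * tau * xt], Young's inequality for the entropy gives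
    [F s >= s * ln a + 1 - a], and the constraint [a x * b y >= cos ^+ 2] says
    that [ln a + ln b + 2 * L1] is nonnegative on the plan.  Clamping [a] and [b]
    between [N^-1] and [N] preserves the constraint and disposes of
    integrability questions for the logarithms.

    The constraint ([hopf_lax_dual_constraint]): the functions [hopf_laxP t xi],
    for [xi >= - 2^-1], satisfy it pairwise.  This is an inequality between three
    points [x], [y], [z]; after a change of parameters it is the trigonometric
    inequality [cone_triangle], whose two sides differ by a perfect square in the
    extremal case.

    Squeezing ([family_optimal]): along a geodesic the bounds for the increments
    of [t |-> int (xi_ t) dmu_t] over [[0, s]], [[s, t]] and [[t, 1]] add up to
    [2^-1 * HK mu0 mu1 ^+ 2].  Tightness gives [hopf_laxP 1 xi0 = bxi1]
    ([hopf_lax1]), so optimality of the pair says that the total increment equals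
    this sum; hence each bound is an equality.  The second family is minus the
    forward family started from [- bxi1], along the reversed geodesic, so the
    same argument applies to it.

    Contact set: the constraint between [t] and [1] yields [bxi_ t <= xi_ t]
    ([hopf_lax_backward_le]).  The two integrals against [mu t] coincide, because
    both families start from [xi0] and have the same increments.  For [0 < t < 1]
    both functions are Lipschitz ([hopf_lax_lipschitz]), so a nonnegative
    continuous function with zero integral vanishes on the support of [mu t].
    At the end points the two families agree everywhere by tightness. *)

Set Implicit Arguments.
Unset Strict Implicit.
Unset Printing Implicit Defensive.

Import Order.TTheory GRing.Theory Num.Theory.
Import numFieldNormedType.Exports.

Local Open Scope classical_set_scope.
Local Open Scope ring_scope.

(** * Euclidean norm and capped cosines *)

Section EuclideanNorm.
Context {R : realType} {d : nat}.
Implicit Types (x y z : 'rV[R]_d).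

Lemma enorm_ge0 x : 0 <= enorm x.
Proof. exact: sqrtr_ge0. Qed.

Lemma sum_sqr_ge0 x : 0 <= \sum_(i < d) x ord0 i ^+ 2.
Proof. by apply: sumr_ge0 => i _; exact: sqr_ge0. Qed.

Lemma enormN x : enorm (- x) = enorm x.
Proof.
by congr Num.sqrt; apply: eq_bigr => i _; rewrite mxE sqrrN.
Qed.

Lemma enormB x y : enorm (x - y) = enorm (y - x).
Proof. by rewrite -enormN opprB. Qed.

Lemma enorm0 : enorm (0 : 'rV[R]_d) = 0.
Proof.
by rewrite /enorm big1 ?sqrtr0// => i _; rewrite mxE expr0n.
Qed.

Lemma enormD x y : enorm (x + y) <= enorm x + enorm y.
Proof.
set a := enorm x; set b := enorm y.
have a0 : 0 <= a := enorm_ge0 x.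
have b0 : 0 <= b := enorm_ge0 y.
have Ea : \sum_(i < d) x ord0 i ^+ 2 = a ^+ 2 by rewrite sqr_sqrtr ?sum_sqr_ge0.
have Eb : \sum_(i < d) y ord0 i ^+ 2 = b ^+ 2 by rewrite sqr_sqrtr ?sum_sqr_ge0.
set c := \sum_(i < d) x ord0 i * y ord0 i.
have quad u v : \sum_(i < d) (u * x ord0 i + v * y ord0 i) ^+ 2
    = u ^+ 2 * a ^+ 2 + 2 * u * v * c + v ^+ 2 * b ^+ 2.
  rewrite -Ea -Eb /c !mulr_sumr -!big_split/=; apply: eq_bigr => i _; ring.
have quad_ge0 u v : 0 <= u ^+ 2 * a ^+ 2 + 2 * u * v * c + v ^+ 2 * b ^+ 2.
  by rewrite -quad; apply: sumr_ge0 => i _; exact: sqr_ge0.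
have cab : c <= a * b.
  (* Cauchy-Schwarz, from the sign of the quadratic form [quad_ge0].  If one
     norm vanishes the form is affine in the other coefficient, which is
     chosen so that the form takes the value -1. *)
  rewrite leNgt; apply/negP => cgt.
  have c0 : c != 0 by rewrite gt_eqF// (le_lt_trans _ cgt)// mulr_ge0.
  have [az|a_neq0] := eqVneq a 0.
    have := quad_ge0 (- (b ^+ 2 + 1) / (2 * c)) 1.
    by have -> : 2 * (- (b ^+ 2 + 1) / (2 * c)) * 1 * c = - (b ^+ 2 + 1);
      [field | rewrite az; lra].
  have [bz|b_neq0] := eqVneq b 0.
    have := quad_ge0 1 (- (a ^+ 2 + 1) / (2 * c)).
    by have -> : 2 * 1 * (- (a ^+ 2 + 1) / (2 * c)) * c = - (a ^+ 2 + 1);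
      [field | rewrite bz; lra].
  have ab0 : 0 < a * b by rewrite mulr_gt0// lt_neqAle eq_sym ?a_neq0 ?b_neq0.
  have := quad_ge0 b (- a).
  have -> : b ^+ 2 * a ^+ 2 + 2 * b * - a * c + (- a) ^+ 2 * b ^+ 2
    = - (2 * (a * b) * (c - a * b)) by ring.
  by rewrite oppr_ge0 leNgt mulr_gt0// ?subr_gt0// mulr_gt0.
rewrite -(ler_pXn2r (n := 2)) ?nnegrE ?enorm_ge0 ?addr_ge0//.
rewrite sqr_sqrtr ?sum_sqr_ge0//.
under eq_bigr => i _ do rewrite mxE -[x _ _]mul1r -[y _ _]mul1r.
rewrite quad; nra.
Qed.

Lemma enorm_triangle x y z : enorm (x - z) <= enorm (x - y) + enorm (y - z).
Proof. by rewrite -[in leLHS](subrK y x) -addrA enormD. Qed.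

End EuclideanNorm.

Section CappedCosine.
Context {R : realType}.
Implicit Types a b g w : R.

(** Capping angles at [pi / 2] makes the cosine vanish outside the ball on which
    the Hopf-Lax infimum and [L1] live, so that bounds known only on that ball
    become bounds on the whole space. *)
Definition cap a : R := Num.min a (pi / 2).

Lemma pihalf_gt0 : 0 < pi / 2 :> R.
Proof. by rewrite divr_gt0// pi_gt0. Qed.

Lemma cap_itv a : 0 <= a -> 0 <= cap a <= pi / 2.
Proof.
by move=> a0; rewrite /cap le_min a0 ge_min lexx orbT/= ltW// pihalf_gt0.
Qed.

Lemma cos_cap_ge0 a : 0 <= a -> 0 <= cos (cap a).
Proof.
move=> /cap_itv/andP[c0 c1]; rewrite cos_ge0_pihalf// c1 andbT.
by rewrite (le_trans _ c0)// oppr_le0 ltW// pihalf_gt0.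
Qed.

Lemma cos_cap_lt a : a < pi / 2 -> cos (cap a) = cos a.
Proof. by move=> /ltW a1; rewrite /cap min_l. Qed.

Lemma cos_cap_ge a : pi / 2 <= a -> cos (cap a) = 0.
Proof. by move=> a1; rewrite /cap min_r// cos_pihalf. Qed.

Lemma cos_sqr_le1 a : cos a ^+ 2 <= 1.
Proof. by rewrite cos2sin2 lerBlDr lerDl sqr_ge0. Qed.

Lemma cos_dist a b : `|cos a - cos b| <= `|a - b|.
Proof.
wlog ab : a b / a <= b.
  move=> H; case: (leP a b) => [/H//|/ltW/H].
  by rewrite distrC [leRHS]distrC.
have [|c _ E] := @MVT_segment R cos (fun x => - sin x) a b ab.
  exact/continuous_subspaceT/continuous_cos.
rewrite distrC E normrM normrN [leRHS]distrC ler_piMl// sin_max//.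
Qed.

Lemma cap_dist a b : `|cap a - cap b| <= `|a - b|.
Proof.
wlog ab : a b / a <= b.
  move=> H; case: (leP a b) => [/H//|/ltW/H].
  by rewrite distrC [leRHS]distrC.
rewrite distrC [leRHS]distrC [leRHS]ger0_norm ?subr_ge0//.
rewrite /cap; case: (leP a (pi / 2)); case: (leP b (pi / 2)) => h1 h2;
  rewrite ger0_norm; lra.
Qed.

Lemma cos_cap_sqr_dist a b :
  cos (cap a) ^+ 2 <= cos (cap b) ^+ 2 + 2 * `|a - b|.
Proof.
have H : `|cos (cap a) - cos (cap b)| <= `|a - b|.
  exact: le_trans (cos_dist _ _) (cap_dist _ _).
have := cos_max (cap a); have := cos_max (cap b); move: H.
rewrite !ler_norml => /andP[H1 H2] /andP[H3 H4] /andP[H5 H6].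
have n0 := normr_ge0 (a - b).
nra.
Qed.

Lemma cos_noninc a b : 0 <= a -> a <= b -> b <= pi -> cos b <= cos a.
Proof.
move=> a0 ab bpi; rewrite leNgt ltr_cos ?in_itv/= ?a0 ?bpi ?andbT -?leNgt//.
  exact: le_trans ab.
exact: le_trans bpi.
Qed.

Lemma cos_le_sin b g : b <= pi / 2 -> 0 <= g <= pi / 2 ->
  pi / 2 <= b + g -> cos b <= sin g.
Proof.
move=> b1 /andP[g0 g1] bg; have p0 := @pi_gt0 R.
have -> : sin g = cos (pi / 2 - g) by rewrite -opprB cosN cosBpihalf.
by apply: cos_noninc; lra.
Qed.

(** This is the triangle inequality of the cone over [R^d].  The right-hand side
    decreases in [a], so [a = b + g] is the worst case; if that sum is below
    [pi / 2] the two sides differ by the square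
    [(w * sin g - sin a * cos b) ^+ 2].  Otherwise [cos b <= sin (cap g)], which
    leaves only products of nonnegative factors. *)
Lemma cone_triangle a b g w : 0 <= a -> 0 <= b <= pi / 2 -> 0 <= g ->
  a <= b + g -> 1 <= w ->
  w * (w - 1) * cos (cap g) ^+ 2 <=
  (w - 1 + cos (cap a) ^+ 2) * (w - cos b ^+ 2).
Proof.
move=> a0 /andP[b0 b1] g0 abg w1.
have /andP[cg0 cg1] := cap_itv g0.
have cb_le1 := cos_sqr_le1 b.
have ca0 := cos_cap_ge0 a0.
have cgE := sin2cos2 (cap g).
have [bg|bg] := leP (pi / 2) (b + cap g).
  have cb0 : 0 <= cos b by apply: cos_ge0_pihalf; lra.
  have cs : cos b ^+ 2 <= sin (cap g) ^+ 2.
    by rewrite ler_pXn2r// ?nnegrE ?(le_trans cb0)// cos_le_sin// cg0.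
  have H1 : 0 <= (w - 1) * (w - cos b ^+ 2 - w * cos (cap g) ^+ 2).
    by rewrite mulr_ge0//; [lra|nra].
  have H2 : 0 <= cos (cap a) ^+ 2 * (w - cos b ^+ 2).
    by rewrite mulr_ge0//; [exact: sqr_ge0|lra].
  nra.
have gE : cap g = g.
  rewrite /cap; apply: min_l; rewrite leNgt; apply/negP => /ltW h.
  by move: bg; rewrite /cap min_r// ltNge lerDr b0.
rewrite gE in cgE bg *.
have aE : cap a = a by rewrite /cap min_l// (le_trans abg)// ltW.
rewrite aE.
have p0 := @pi_gt0 R.
have cab : cos (b + g) <= cos a by apply: cos_noninc => //; lra.
have cbg : 0 <= cos (b + g) by apply: cos_ge0_pihalf; lra.
have ca2 : cos (b + g) ^+ 2 <= cos a ^+ 2.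
  by rewrite ler_pXn2r// nnegrE (le_trans cbg).
apply: (@le_trans _ _ ((w - 1 + cos (b + g) ^+ 2) * (w - cos b ^+ 2))); last first.
  by rewrite ler_wpM2r ?lerD2l//; lra.
have key : sin (b + g) ^+ 2 + cos b ^+ 2 - cos g ^+ 2
    = 2 * sin g * sin (b + g) * cos b.
  apply/eqP; rewrite -subr_eq0 sinD; apply/eqP.
  transitivity (sin b ^+ 2 * cos g ^+ 2 - cos b ^+ 2 * sin g ^+ 2
                + cos b ^+ 2 - cos g ^+ 2); first by ring.
  by rewrite !sin2cos2; ring.
rewrite -subr_ge0.
suff -> : (w - 1 + cos (b + g) ^+ 2) * (w - cos b ^+ 2)
    - w * (w - 1) * cos g ^+ 2 = (w * sin g - sin (b + g) * cos b) ^+ 2.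
  exact: sqr_ge0.
transitivity (w ^+ 2 * sin g ^+ 2 - w * (sin (b + g) ^+ 2 + cos b ^+ 2 - cos g ^+ 2)
  + sin (b + g) ^+ 2 * cos b ^+ 2); last by rewrite key; ring.
by rewrite !(sin2cos2 (b + g)) (sin2cos2 g); ring.
Qed.

End CappedCosine.

Lemma cos_enorm_gt0 {R : realType} {d : nat} (z : 'rV[R]_d) :
  enorm z < pi / 2 -> 0 < cos (enorm z).
Proof.
move=> zpi; apply: cos_gt0_pihalf; rewrite zpi andbT.
by rewrite (lt_le_trans _ (enorm_ge0 _))// oppr_lt0 pihalf_gt0.
Qed.

(** * Densities and marginals *)

Section Densities.
Local Open Scope ereal_scope.

(** The density [s] and the Radon-Nikodym derivative have the same integrals over
    all measurable sets, hence agree almost everywhere; the change of variables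
    known for the derivative then transfers to [s]. *)
Lemma ge0_integral_density d (T : measurableType d) (R : realType)
    (mu : {finite_measure set T -> \bar R}) (nu : {measure set T -> \bar R})
    (s : T -> R) (f : T -> \bar R) :
    fin_num_fun nu -> measurable_fun setT s -> (forall x, 0 <= s x)%R ->
    (forall A, measurable A -> nu A = \int[mu]_(x in A) (s x)%:E) ->
    measurable_fun setT f -> (forall x, 0 <= f x) ->
  \int[nu]_x f x = \int[mu]_x (f x * (s x)%:E).
Proof.
move=> nufin ms s0 nuE mf f0.
pose nu_fin := isFinite.Build _ _ _ _ nufin.
have nusig : sigma_finite setT nu.
  by apply: fin_num_fun_sigma_finite => //; rewrite measure0.
pose nu_sigma := isSigmaFinite.Build _ _ _ _ nusig.
pose nu_sfin := isSFinite.Build _ _ _ _ (sfinite_measure_sigma_finite nusig).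
pose fnu := HB.pack_for (FiniteMeasure.type T R) (Measure.sort nu)
  nu_fin nu_sfin nu_sigma.
have numu : fnu `<< mu.
  apply/null_content_dominatesP => A mA A0.
  rewrite [LHS]nuE// null_set_integral//.
  by apply/measurable_EFinP; exact: measurable_funTS.
have mRN : measurable_fun setT (Radon_Nikodym_SigmaFinite.f fnu mu).
  exact: measurable_int (Radon_Nikodym_SigmaFinite.f_integrable _).
have aeq : ae_eq mu setT (Radon_Nikodym_SigmaFinite.f fnu mu) (EFin \o s).
  apply: integral_ae_eq => //.
  - exact: Radon_Nikodym_SigmaFinite.f_integrable.
  - exact/measurable_EFinP.
  - move=> A _ mA; rewrite -Radon_Nikodym_SigmaFinite.f_integral//.
    exact: nuE.
rewrite -[LHS](Radon_Nikodym_SigmaFinite.change_of_variables numu)//.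
apply: ge0_ae_eq_integral => //.
- exact: emeasurable_funM.
- by apply: emeasurable_funM => //; exact/measurable_EFinP.
- by move=> y _; rewrite mule_ge0// Radon_Nikodym_SigmaFinite.f_ge0.
- by move=> y _; rewrite mule_ge0// lee_fin.
- by apply: filterS aeq => y /= /(_ I) -> _.
Qed.

Lemma ge0_integral_marginal d1 d2 (X : measurableType d1)
    (Y : measurableType d2) (R : realType) (phi : X -> Y)
    (eta : {finite_measure set X -> \bar R})
    (mu : {finite_measure set Y -> \bar R}) (s : Y -> R) (f : Y -> \bar R) :
    measurable_fun setT phi ->
    measurable_fun setT s -> (forall y, 0 <= s y)%R ->
    (forall A, measurable A -> pushforward eta phi A = \int[mu]_(y in A) (s y)%:E) ->
    measurable_fun setT f -> (forall y, 0 <= f y) ->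
  \int[mu]_y (f y * (s y)%:E) = \int[eta]_x f (phi x).
Proof.
move=> mphi ms s0 dens mf f0.
pose push : {measure set Y -> \bar R} := pushforward eta phi.
rewrite -(@ge0_integral_density _ _ _ mu (push mphi))//.
  exact: (ge0_integral_pushforward mphi eta measurableT mf).
move=> A mA; rewrite /= /pushforward fin_num_measure//.
by rewrite -[_ @^-1` _]setTI; exact: mphi.
Qed.

End Densities.

(** * Borel measurability and the entropy *)

Section BorelMeasurability.
Context {R : realType} {d : nat}.
Local Notation V := 'rV[R]_d.
Local Notation T := (borelRd R d).
Local Open Scope ereal_scope.

Lemma lsc_borel_measurable (f : V -> \bar R) :
  lower_semicontinuous f -> measurable_fun [set: T] (f : T -> \bar R).
Proof.
move=> /lower_semicontinuousP fo.
apply: (measurability _ (ErealGenOInfty.measurableE R)).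
move=> /= _ [_ [a ->]] <-; rewrite setTI; apply: sub_sigma_algebra.
by rewrite preimage_itvoy; exact: fo.
Qed.

Lemma usc_borel_measurable (f : V -> \bar R) :
  upper_semicontinuous f -> measurable_fun [set: T] (f : T -> \bar R).
Proof.
move=> fo.
have -> : (f : T -> \bar R) = \- (\- f) by apply/funext => x; rewrite oppeK.
apply: measurableT_comp => //; apply: lsc_borel_measurable.
move=> x a; rewrite lteNr => /fo[U xU Uf]; exists U => // y /Uf.
by rewrite lteNr.
Qed.

Lemma continuous_borel_measurable (f : V -> R) :
  continuous f -> measurable_fun [set: T] (f : T -> R).
Proof.
move=> cf; apply/measurable_EFinP; apply: lsc_borel_measurable => x a.
rewrite lte_fin => afx.
exists [set y | (a < f y)%R]; last by move=> y; rewrite /= lte_fin.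
exact: (cf x _ (lt_nbhsr afx)).
Qed.

Lemma measurable_dist :
  measurable_fun [set: T * T] (fun p => enorm ((p.1 : V) - (p.2 : V))%R).
Proof.
have msqrt : measurable_fun [set: R] (@Num.sqrt R).
  by apply: continuous_measurable_fun; exact: sqrt_continuous.
have mcoord i : measurable_fun [set: T] (fun x : T => (x : V) ord0 i).
  by apply: continuous_borel_measurable => x; exact: coord_continuous.
have msum : measurable_fun [set: T * T]
    (fun p => \sum_(i < d) ((p.1 : V) - (p.2 : V))%R ord0 i ^+ 2)%R.
  apply: measurable_sum => i; apply: measurable_funX; under eq_fun do rewrite !mxE.
  apply: measurable_funB.
    by apply: (measurableT_comp (mcoord i)); exact: measurable_fst.
  by apply: (measurableT_comp (mcoord i)); exact: measurable_snd.
exact: measurableT_comp msqrt msum.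
Qed.

Lemma measurable_L1 :
  measurable_fun [set: T * T] (fun p => L1 ((p.1 : V) - (p.2 : V))%R).
Proof.
rewrite /L1; apply: measurable_fun_ifT.
- by apply: measurable_fun_ltr => //; exact: measurable_dist.
- have mcos : measurable_fun [set: R] (@cos R).
    by apply: continuous_measurable_fun; exact: continuous_cos.
  apply/measurable_EFinP; apply: measurableT_comp => //.
  exact: measurableT_comp (measurableT_comp mcos measurable_dist).
- exact: measurable_cst.
Qed.

End BorelMeasurability.

Section Entropy.
Context {R : realType}.

(** With [a = expR p] this is the Fenchel inequality between [entropyF] and its
    conjugate [p |-> expR p - 1]. *)
Lemma entropyF_young (s a : R) : 0 <= s -> 0 < a ->
  s * ln a + 1 <= entropyF s + a.
Proof.
move=> s0 a0; rewrite /entropyF; case: eqP => [->|/eqP sN0].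
  by rewrite mul0r add0r lerDl ltW.
have sp : 0 < s by rewrite lt_neqAle eq_sym sN0.
have : ln (a / s) <= a / s - 1.
  have := @le_ln1Dx R (a / s - 1); rewrite [1 + _]addrC subrK; apply.
  by rewrite ltrBDr addrC subrr divr_gt0.
rewrite ln_div ?posrE// -(ler_pM2l sp) mulrBr mulrBr mulrCA divff ?gt_eqF// !mulr1.
lra.
Qed.

Lemma entropyF_ge0 (s : R) : 0 <= s -> 0 <= entropyF s.
Proof. by move=> /entropyF_young/(_ ltr01); rewrite ln1 mulr0 add0r lerDr. Qed.

Lemma measurable_entropyF : measurable_fun [set: R] (@entropyF R).
Proof.
apply: measurable_fun_ifT => //.
  by apply: measurable_fun_eqr => //; exact: measurable_cst.
apply: measurable_funD => //; apply: measurable_funB => //.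
exact: measurable_funM.
Qed.

End Entropy.

Section IntegratedYoung.
Context {R : realType} {d : nat}.
Local Notation V := 'rV[R]_d.
Local Notation T := (borelRd R d).
Local Notation fmeas := {finite_measure set T -> \bar R}.
Local Open Scope ereal_scope.

Lemma L1_ge0 (z : V) : 0 <= L1 z.
Proof.
rewrite /L1; case: ifPn => // _; rewrite lee_fin oppr_ge0.
by apply: ln_le0; exact: cos_le1.
Qed.

Lemma HK_cost_ge0 (mu0 mu1 : fmeas) eta s0 s1 :
  (forall x, 0 <= s0 x)%R -> (forall x, 0 <= s1 x)%R ->
  0 <= HK_cost mu0 mu1 eta s0 s1.
Proof.
move=> s00 s10; apply: adde_ge0; [apply: adde_ge0|]; apply: integral_ge0 => x _.
- by rewrite lee_fin entropyF_ge0.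
- by rewrite lee_fin entropyF_ge0.
- by rewrite mule_ge0// L1_ge0.
Qed.

(** The shift by [l] makes every integrand nonnegative, so that the inequality
    also makes sense, and holds, when the entropy has infinite integral. *)
Lemma integral_entropyF_young (mu : fmeas) (s a : T -> R) (l : R) :
  measurable_fun setT s -> (forall x, 0 <= s x)%R ->
  measurable_fun setT a -> (0 <= l)%R ->
  (forall x, 0 < a x)%R -> (forall x, 0 <= ln (a x) + l)%R ->
  \int[mu]_x ((ln (a x) + l)%:E * (s x)%:E) + mu setT <=
  \int[mu]_x (entropyF (s x))%:E + \int[mu]_x (a x)%:E
  + l%:E * \int[mu]_x (s x)%:E.
Proof.
move=> ms s0 ma l0 a0 al.
have mF : measurable_fun setT (fun x => (entropyF (s x))%:E).
  by apply/measurable_EFinP; exact: measurableT_comp measurable_entropyF ms.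
have mln : measurable_fun setT (fun x => (ln (a x) + l)%:E).
  apply/measurable_EFinP; apply: measurable_funD => //.
  exact: measurableT_comp.
have ms' : measurable_fun setT (fun x => (s x)%:E) by exact/measurable_EFinP.
have ma' : measurable_fun setT (fun x => (a x)%:E) by exact/measurable_EFinP.
have a0' x : setT x -> 0 <= (a x)%:E by rewrite lee_fin ltW.
have s0' x : setT x -> 0 <= (s x)%:E by rewrite lee_fin.
have F0 x : setT x -> 0 <= (entropyF (s x))%:E.
  by rewrite lee_fin entropyF_ge0.
rewrite -[mu setT]mul1e -integral_cst// -ge0_integralZl//.
rewrite -!ge0_integralD//=; last first.
- exact: emeasurable_funM.
- by move=> x _; rewrite mule_ge0// lee_fin ?s0.
- exact: measurable_funeM.
- by move=> x _; rewrite mule_ge0// lee_fin ?s0.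
- exact: emeasurable_funD.
- by move=> x _; rewrite adde_ge0// ?F0// a0'.
apply: ge0_le_integral => //.
- by move=> x _; rewrite adde_ge0// mule_ge0// lee_fin ?s0.
- by apply: emeasurable_funD => //; exact: emeasurable_funM.
- by apply: emeasurable_funD; [exact: emeasurable_funD|exact: measurable_funeM].
move=> x _; rewrite -!EFinM -!EFinD lee_fin.
have := entropyF_young (s0 x) (a0 x); lra.
Qed.

End IntegratedYoung.

(** * Weak duality for the Hellinger-Kantorovich distance *)

Section BoundedWeakDuality.
Context {R : realType} {d : nat}.
Local Notation V := 'rV[R]_d.
Local Notation T := (borelRd R d).
Local Notation fmeas := {finite_measure set T -> \bar R}.
Local Open Scope ereal_scope.

Lemma fin_finite_measure (mu : fmeas) : mu setT \is a fin_num.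
Proof. exact: fin_num_measure. Qed.

(** The logarithm of the product constraint: [ln a] and [ln b] are, up to sign,
    an admissible pair of potentials for the cost [2 * L1]. *)
Lemma log_cost_ge0 (x y : V) (a b : R) :
  (0 < a)%R -> (0 < b)%R -> (cos (cap (enorm (x - y))) ^+ 2 <= a * b)%R ->
  (- (ln a + ln b))%:E <= 2%:E * L1 (x - y)%R.
Proof.
move=> a0 b0; rewrite /L1; case: ifPn => [xy|_ _]; last first.
  by rewrite gt0_muley ?lte_fin// leey.
rewrite cos_cap_lt// -EFinM lee_fin mulrN lerN2 -lnM ?posrE// => cab.
have c0 := cos_enorm_gt0 xy.
by rewrite mulr_natl -lnXn// ler_ln ?posrE ?exprn_gt0 ?mulr_gt0.
Qed.

(** Young's inequality is integrated against both marginals.  The terms in [ln a]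
    and [ln b] are integrals over the plan, where the constraint bounds them
    below by minus the transport cost; the bounds by [N] make the logarithms
    bounded, and the shifts by [ln N] cancel. *)
Lemma weak_duality_bounded (mu0 mu1 : fmeas)
    (eta : {finite_measure set (T * T)%type -> \bar R}) (s0 s1 a b : T -> R)
    (N : R) :
  has_marginals mu0 mu1 eta s0 s1 -> (1 <= N)%R ->
  measurable_fun setT a -> measurable_fun setT b ->
  (forall x, N^-1 <= a x)%R -> (forall x, N^-1 <= b x)%R ->
  \int[mu0]_x (a x)%:E < +oo -> \int[mu1]_x (b x)%:E < +oo ->
  (forall x y : V, cos (cap (enorm (x - y))) ^+ 2 <= a x * b y)%R ->
  mu0 setT + mu1 setT <=
  \int[mu0]_x (a x)%:E + \int[mu1]_x (b x)%:E + HK_cost mu0 mu1 eta s0 s1.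
Proof.
move=> [[ms0 ms1] [s00 s10] m0 m1] N1 ma mb aN bN ia ib ab.
have N0 : (0 < N)%R by apply: lt_le_trans N1.
have Ni0 : (0 < N^-1)%R by rewrite invr_gt0.
have a0 x : (0 < a x)%R := lt_le_trans Ni0 (aN x).
have b0 x : (0 < b x)%R := lt_le_trans Ni0 (bN x).
set l := ln N.
have l0 : (0 <= l)%R by exact: ln_ge0.
have lnN_ge0 c : (N^-1 <= c)%R -> (0 <= ln c + l)%R.
  move=> Nc; have c0 : (0 < c)%R := lt_le_trans Ni0 Nc.
  by rewrite -lnM ?posrE// ln_ge0// -ler_pdivrMr// div1r.
have al x := lnN_ge0 _ (aN x).
have bl x := lnN_ge0 _ (bN x).
have Y0 := integral_entropyF_young mu0 ms0 s00 ma l0 a0 al.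
have Y1 := integral_entropyF_young mu1 ms1 s10 mb l0 b0 bl.
have mlna : measurable_fun [set: T] (fun x => (ln (a x) + l)%:E).
  by apply/measurable_EFinP; apply: measurable_funD => //; exact: measurableT_comp.
have mlnb : measurable_fun [set: T] (fun x => (ln (b x) + l)%:E).
  by apply/measurable_EFinP; apply: measurable_funD => //; exact: measurableT_comp.
have mfst : measurable_fun [set: T * T] (@fst T T) by exact: measurable_fst.
have msnd : measurable_fun [set: T * T] (@snd T T) by exact: measurable_snd.
have X0 := ge0_integral_marginal mfst ms0 s00 m0 mlna (fun x => al x).
have X1 := ge0_integral_marginal msnd ms1 s10 m1 mlnb (fun x => bl x).
have S0 : \int[mu0]_x (s0 x)%:E = eta setT by rewrite -m0.
have S1 : \int[mu1]_x (s1 x)%:E = eta setT by rewrite -m1.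
have K : (2 * l)%:E * eta setT <=
    \int[eta]_p (ln (a p.1) + l)%:E + \int[eta]_p (ln (b p.2) + l)%:E
    + \int[eta]_p (2%:E * L1 ((p.1 : V) - (p.2 : V))%R).
  rewrite -integral_cst//.
  have m2 := measurable_funeM 2%:E (@measurable_L1 R d).
  have ma1 := measurableT_comp mlna mfst.
  have mb2 := measurableT_comp mlnb msnd.
  rewrite -!ge0_integralD//=.
  - apply: ge0_le_integral => //.
    + by move=> p _; rewrite lee_fin mulr_ge0.
    + by apply: emeasurable_funD => //; exact: emeasurable_funD.
    move=> p _.
    have := log_cost_ge0 (a0 p.1) (b0 p.2) (ab p.1 p.2).
    case: (2%:E * _) => [r| |]//=; last by rewrite ?leey.
    by rewrite -!EFinD !lee_fin; lra.
  - by move=> p _; rewrite -EFinD lee_fin addr_ge0.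
  - exact: emeasurable_funD.
  - by move=> p _; rewrite mule_ge0// L1_ge0.
  - by move=> p _; rewrite lee_fin.
  - by move=> p _; rewrite lee_fin.
have F00 : 0 <= \int[mu0]_x (entropyF (s0 x))%:E.
  by apply: integral_ge0 => x _; rewrite lee_fin entropyF_ge0.
have F10 : 0 <= \int[mu1]_x (entropyF (s1 x))%:E.
  by apply: integral_ge0 => x _; rewrite lee_fin entropyF_ge0.
have L0 : 0 <= \int[eta]_p (2%:E * L1 ((p.1 : V) - (p.2 : V))%R).
  by apply: integral_ge0 => x _; rewrite mule_ge0// L1_ge0.
have A0 : 0 <= \int[mu0]_x (a x)%:E.
  by apply: integral_ge0 => x _; rewrite lee_fin ltW.
have B0 : 0 <= \int[mu1]_x (b x)%:E.
  by apply: integral_ge0 => x _; rewrite lee_fin ltW.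
have Z0 : 0 <= \int[eta]_p (ln (a p.1) + l)%:E.
  by apply: integral_ge0 => x _; rewrite lee_fin.
have Z1 : 0 <= \int[eta]_p (ln (b p.2) + l)%:E.
  by apply: integral_ge0 => x _; rewrite lee_fin.
have M0 := fin_finite_measure mu0.
have M1 := fin_finite_measure mu1.
have E : eta setT \is a fin_num by exact: fin_num_measure.
move: Y0 Y1 K; rewrite /HK_cost X0 X1 S0 S1 {X0 X1 S0 S1 m0 m1}.
move: F00 F10 L0 A0 B0 Z0 Z1 M0 M1 E ia ib.
move: (\int[eta]_p (ln (a p.1) + l)%:E) (\int[eta]_p (ln (b p.2) + l)%:E)
  (\int[mu0]_x (entropyF (s0 x))%:E) (\int[mu1]_x (entropyF (s1 x))%:E)
  (\int[mu0]_x (a x)%:E) (\int[mu1]_x (b x)%:E)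
  (\int[eta]_p (2%:E * L1 ((p.1 : V) - (p.2 : V))%R))
  (mu0 setT) (mu1 setT) (eta setT).
move=> z0 z1 f0 f1 i j k p q e.
case: p => [p||]//; case: q => [q||]//; case: e => [e||]//.
case: i => [i||]//; case: j => [j||]//.
case: f0 => [f0||]//; case: f1 => [f1||]//; case: k => [k||]//;
  try by move=> *; rewrite /= leey.
case: z0 => [z0||]//; case: z1 => [z1||]//.
rewrite -!EFinM -!EFinD !lee_fin; nra.
Qed.

End BoundedWeakDuality.

Section Clamp.
Context {R : realType}.
Local Open Scope ereal_scope.

Definition clamp (N : R) (z : \bar R) : R :=
  fine (maxe N^-1%:E (mine z N%:E)).

Lemma clampE (N : R) (z : \bar R) : (1 <= N)%R -> 0 <= z ->
  clamp N z = if z is r%:E then Num.max N^-1%R (Num.min r N) else N.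
Proof.
move=> N1; have N0 : (0 < N)%R by apply: lt_le_trans N1.
case: z => [r _||]//; first by rewrite /clamp -EFin_min -EFin_max.
move=> _; rewrite /clamp min_r ?leey// -EFin_max/= max_r//.
by rewrite (@le_trans _ _ 1%R)// invf_le1.
Qed.

Lemma measurable_clamp d (T : measurableType d) (N : R) (f : T -> \bar R) :
  measurable_fun setT f -> measurable_fun setT (fun x => clamp N (f x)).
Proof.
move=> mf; apply: (measurableT_comp (f := fine)).
  exact: fine_measurable.
by apply: measurable_maxe => //; exact: measurable_mine.
Qed.

Lemma clamp_ge (N : R) (z : \bar R) : (1 <= N)%R -> 0 <= z ->
  (N^-1 <= clamp N z)%R.
Proof.
move=> N1 z0; rewrite clampE//; case: z z0 => [r| |]//= _.
  by rewrite le_max lexx.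
by rewrite (@le_trans _ _ 1%R)// invf_le1// (lt_le_trans _ N1).
Qed.

Lemma clamp_le (N : R) (z : \bar R) : (1 <= N)%R -> 0 <= z ->
  (clamp N z)%:E <= z + N^-1%:E.
Proof.
move=> N1 z0; rewrite clampE//; case: z z0 => [r| |]//= r0; last by rewrite leey.
rewrite -EFinD lee_fin ge_max ge_min.
have Ni : (0 <= N^-1)%R by rewrite invr_ge0 (le_trans _ N1).
by rewrite lerDr lerDl Ni -lee_fin r0.
Qed.

(** Truncating two functions at the same levels [N^-1] and [N] preserves the
    product constraint: where one factor is cut at [N], the other is at least
    [N^-1], and the product is at least [1]. *)
Lemma clamp_prod (N c : R) (y z : \bar R) : (1 <= N)%R -> (c <= 1)%R ->
  0 <= y -> 0 <= z -> (y < +oo -> z < +oo -> c%:E <= y * z) ->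
  (c <= clamp N y * clamp N z)%R.
Proof.
move=> N1 c1 y0 z0 H.
have N0 : (0 < N)%R by apply: lt_le_trans N1.
have Ni : (0 < N^-1)%R by rewrite invr_gt0.
have big (u v : \bar R) : 0 <= u -> 0 <= v -> N%:E <= u ->
    (c <= clamp N u * clamp N v)%R.
  move=> u0 v0 Nu; apply: (le_trans c1).
  have -> : clamp N u = N.
    rewrite clampE//; case: u u0 Nu => [r| |]//= _; rewrite lee_fin => Nr.
    by rewrite min_r// max_r// (@le_trans _ _ 1%R)// invf_le1.
  rewrite -[leLHS](@mulfV _ N) ?gt_eqF// ler_wpM2l ?(ltW N0)//.
  exact: clamp_ge.
have [/big|yN] := leP N%:E y; first exact.
have [Nz|zN] := leP N%:E z; first by rewrite mulrC; exact: big.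
have := H (lt_trans yN (ltry _)) (lt_trans zN (ltry _)).
move: y z {H big} y0 z0 yN zN => [y| |]// [z| |]//.
rewrite !lee_fin !lte_fin => y0 z0 yN zN /le_trans; apply.
rewrite !clampE ?lee_fin//= !(min_l (ltW _))//.
by rewrite ler_pM// le_max lexx orbT.
Qed.

End Clamp.

Section WeakDuality.
Context {R : realType} {d : nat}.
Local Notation V := 'rV[R]_d.
Local Notation T := (borelRd R d).
Local Notation fmeas := {finite_measure set T -> \bar R}.
Local Open Scope ereal_scope.

Lemma HK_sqr (mu0 mu1 : fmeas) : HK mu0 mu1 ^+ 2 =
  ereal_inf [set c | exists eta s0 s1,
    has_marginals mu0 mu1 eta s0 s1 /\ c = HK_cost mu0 mu1 eta s0 s1].
Proof.
rewrite sqr_sqrte//; apply: le_ereal_inf_tmp => _ [eta [s0 [s1 [[_ [s00 s10] _ _] ->]]]].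
exact: HK_cost_ge0.
Qed.

(** Unbounded [a] and [b], whose logarithms need not be integrable, are clamped;
    clamping costs at most [N^-1] times the total mass. *)
Lemma weak_duality (mu0 mu1 : fmeas) (a b : T -> \bar R) :
  measurable_fun setT a -> measurable_fun setT b ->
  (forall x, 0 <= a x) -> (forall x, 0 <= b x) ->
  \int[mu0]_x a x < +oo -> \int[mu1]_x b x < +oo ->
  (forall x y : V, a x < +oo -> b y < +oo ->
    (cos (cap (enorm (x - y))) ^+ 2)%:E <= a x * b y) ->
  mu0 setT + mu1 setT <=
  \int[mu0]_x a x + \int[mu1]_x b x + HK mu0 mu1 ^+ 2.
Proof.
move=> ma mb a0 b0 ia ib ab.
have A0 : 0 <= \int[mu0]_x a x by exact: integral_ge0.
have B0 : 0 <= \int[mu1]_x b x by exact: integral_ge0.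
have fa : \int[mu0]_x a x \is a fin_num by rewrite ge0_fin_numE.
have fb : \int[mu1]_x b x \is a fin_num by rewrite ge0_fin_numE.
have fab : \int[mu0]_x a x + \int[mu1]_x b x \is a fin_num.
  by rewrite fin_numD fa fb.
rewrite -leeBlDl//.
rewrite HK_sqr.
apply: le_ereal_inf_tmp => _ [eta [s0 [s1 [marg ->]]]].
rewrite leeBlDl//.
apply/lee_addgt0Pr => e e0.
have M0 := fin_finite_measure mu0; have M1 := fin_finite_measure mu1.
pose m := fine (mu0 setT + mu1 setT).
have mE : mu0 setT + mu1 setT = m%:E by rewrite fineK// fin_numD M0.
have m0 : (0 <= m)%R by rewrite fine_ge0// adde_ge0.
(* [N] is such that [N^-1 * m <= e]. *)
pose N := (1 + m / e)%R.
have N1 : (1 <= N)%R by rewrite lerDl divr_ge0// ltW.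
have N0 : (0 < N)%R by apply: lt_le_trans N1.
have clamped (mu : fmeas) (f : T -> \bar R) :
    measurable_fun setT f -> (forall x, 0 <= f x) ->
    \int[mu]_x (clamp N (f x))%:E <= \int[mu]_x f x + N^-1%:E * mu setT.
  move=> mf f0; rewrite -integral_cst// -ge0_integralD//; last first.
    by move=> x _ /=; rewrite lee_fin invr_ge0 ltW.
  apply: ge0_le_integral => //.
  - by move=> x _; rewrite lee_fin (le_trans _ (clamp_ge N1 (f0 x)))// invr_ge0 ltW.
  - exact/measurable_EFinP/measurable_clamp.
  - exact: emeasurable_funD.
  - by move=> x _; exact: clamp_le.
have ca := clamped mu0 a ma a0; have cb := clamped mu1 b mb b0.
have fin_lt (mu : fmeas) z : z \is a fin_num -> z + N^-1%:E * mu setT < +oo.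
  move=> fz; rewrite ltey_eq fin_numD fz/= fin_numM//.
  exact: fin_finite_measure.
have main : mu0 setT + mu1 setT <= \int[mu0]_x (clamp N (a x))%:E +
   \int[mu1]_x (clamp N (b x))%:E + HK_cost mu0 mu1 eta s0 s1.
  apply: (weak_duality_bounded marg N1).
  - exact: measurable_clamp.
  - exact: measurable_clamp.
  - by move=> x; exact: clamp_ge.
  - by move=> x; exact: clamp_ge.
  - exact: le_lt_trans ca (fin_lt _ _ fa).
  - exact: le_lt_trans cb (fin_lt _ _ fb).
  - move=> x y.
    exact: (clamp_prod N1 (cos_sqr_le1 _) (a0 x) (b0 y) (ab x y)).
apply: (le_trans main).
apply: (@le_trans _ _ (\int[mu0]_x a x + N^-1%:E * mu0 setT +
  (\int[mu1]_x b x + N^-1%:E * mu1 setT) + HK_cost mu0 mu1 eta s0 s1)).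
  by rewrite leeD2r// leeD.
rewrite addeACA -ge0_muleDr// mE -EFinM.
rewrite -[leRHS]addeA [_ + e%:E]addeC addeA leeD2r// leeD2l// lee_fin.
rewrite ler_pdivrMl// /N mulrDl mul1r divfK ?gt_eqF//.
by rewrite lerDr ltW.
Qed.

End WeakDuality.

(** * The Hopf-Lax operator and its semigroup inequality *)

Section HopfLax.
Context {R : realType} {d : nat}.
Local Notation V := 'rV[R]_d.
Implicit Types (x y z : V) (xi : V -> \bar R) (s t r : R).
Local Open Scope ereal_scope.

Definition hopf_lax_term t xi x y : \bar R :=
  (2 * t)^-1%:E *
  (1 - (cos (enorm (x - y)) ^+ 2)%:E / (1 + (2 * t)%:E * xi y)).

Lemma hopf_laxPE t xi x : (0 < t)%R -> hopf_laxP t xi x =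
  ereal_inf [set hopf_lax_term t xi x y
            | y in [set y | enorm (y - x) < pi / 2]%R].
Proof. by move=> t0; rewrite /hopf_laxP gt_eqF. Qed.

Lemma hopf_lax_le t xi x y : (0 < t)%R -> (enorm (x - y) < pi / 2)%R ->
  hopf_laxP t xi x <= hopf_lax_term t xi x y.
Proof.
move=> t0 xy; rewrite hopf_laxPE//; apply: ereal_inf_lbound.
by exists y => //=; rewrite enormB.
Qed.

Lemma le_hopf_lax t xi x m : (0 < t)%R ->
  (forall y, (enorm (x - y) < pi / 2)%R -> m <= hopf_lax_term t xi x y) ->
  m <= hopf_laxP t xi x.
Proof.
move=> t0 H; rewrite hopf_laxPE//; apply: le_ereal_inf_tmp => _ [y /= xy <-].
by apply: H; rewrite enormB.
Qed.

Lemma hopf_lax_term_fin t xi x y r : xi y = r%:E -> (1 + 2 * t * r != 0)%R ->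
  hopf_lax_term t xi x y =
  ((2 * t)^-1 * (1 - cos (enorm (x - y)) ^+ 2 / (1 + 2 * t * r)))%:E.
Proof.
move=> E u0; rewrite /hopf_lax_term E -EFinM -EFinD inver (negbTE u0).
by rewrite [in RHS]EFinM EFinB EFinM.
Qed.

Lemma hopf_lax_term_y t xi x y : (0 < t)%R -> xi y = +oo ->
  hopf_lax_term t xi x y = ((2 * t)^-1)%:E.
Proof.
move=> t0 E; rewrite /hopf_lax_term E gt0_muley ?lte_fin ?mulr_gt0//.
by rewrite addey// invey mule0 sube0 mule1.
Qed.

Lemma hopf_lax_term_Ny t xi x y r : (0 < t)%R -> xi y = r%:E ->
  (1 + 2 * t * r = 0)%R -> (enorm (x - y) < pi / 2)%R ->
  hopf_lax_term t xi x y = -oo.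
Proof.
move=> t0 E u0 xy; rewrite /hopf_lax_term E -EFinM -EFinD u0 inve0.
have c0 := cos_enorm_gt0 xy.
rewrite gt0_muley ?lte_fin ?exprn_gt0// addeNy// gt0_muleNy//.
by rewrite lte_fin invr_gt0 mulr_gt0.
Qed.

Section LowerBound.
Variable xi : V -> \bar R.
Hypothesis xi_ge : forall y, (- 2^-1)%:E <= xi y.

Lemma denom_ge t r y : xi y = r%:E -> (0 <= t)%R -> (1 - t <= 1 + 2 * t * r)%R.
Proof. by move=> E t0; have := xi_ge y; rewrite E lee_fin => ?; nra. Qed.

Lemma xi_neqNy y : xi y != -oo.
Proof. by have := xi_ge y; case: (xi y). Qed.

(** The point [x] itself competes in the infimum. *)
Lemma hopf_lax_half t x : (0 < t <= 1)%R ->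
  hopf_laxP t xi x <= ((2 * t)^-1)%:E.
Proof.
move=> /andP[t0 t1].
have xx : (enorm (x - x) < pi / 2)%R by rewrite subrr enorm0 pihalf_gt0.
apply: (le_trans (hopf_lax_le xi t0 xx)).
case E : (xi x) => [r| |]; last by have := xi_neqNy x; rewrite E.
  have := denom_ge E (ltW t0).
  have [u0|u0] := eqVneq (1 + 2 * t * r)%R 0%R.
    by rewrite (hopf_lax_term_Ny t0 E u0 xx) leNye.
  move=> h; rewrite (hopf_lax_term_fin x E u0) lee_fin ler_piMr//.
    by rewrite invr_ge0 mulr_ge0// ltW.
  by rewrite gerBl divr_ge0// ?sqr_ge0// (le_trans _ h)// subr_ge0.
by rewrite hopf_lax_term_y.
Qed.

(** Outside the ball the capped cosine vanishes and the bound is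
    [hopf_lax_half]. *)
Lemma hopf_lax_le_cap t x y r : (0 < t <= 1)%R -> xi y = r%:E ->
  (0 < 1 + 2 * t * r)%R ->
  hopf_laxP t xi x <=
  ((2 * t)^-1 * (1 - cos (cap (enorm (x - y))) ^+ 2 / (1 + 2 * t * r)))%:E.
Proof.
move=> t01 E u0; have /andP[t0 t1] := t01.
have [xy|xy] := ltP (enorm (x - y)) (pi / 2)%R.
  apply: (le_trans (hopf_lax_le xi t0 xy)).
  by rewrite (hopf_lax_term_fin x E) ?gt_eqF// cos_cap_lt.
rewrite cos_cap_ge// expr0n/= mul0r subr0 mulr1.
exact: hopf_lax_half.
Qed.

Lemma hopf_lax_ge t x : (0 < t < 1)%R ->
  (- (2 * (1 - t))^-1)%:E <= hopf_laxP t xi x.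
Proof.
move=> /andP[t0 t1]; apply: le_hopf_lax => // y xy.
have t1' : (0 < 1 - t)%R by rewrite subr_gt0.
case E : (xi y) => [r| |]; last by have := xi_neqNy y; rewrite E.
  have u := denom_ge E (ltW t0).
  have u0 : (0 < 1 + 2 * t * r)%R by apply: lt_le_trans u.
  rewrite (hopf_lax_term_fin x E) ?gt_eqF// lee_fin.
  have -> : (- (2 * (1 - t))^-1 = (2 * t)^-1 * (1 - 1 / (1 - t)) :> R)%R.
    by field; rewrite !gt_eqF.
  rewrite ler_pM2l ?invr_gt0 ?mulr_gt0// lerD2l lerN2.
  by rewrite ler_pM ?sqr_ge0 ?invr_ge0 ?cos_sqr_le1 ?(ltW u0)// lef_pV2 ?posrE.
rewrite hopf_lax_term_y// lee_fin (@le_trans _ _ 0%R)//.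
  by rewrite oppr_le0 invr_ge0 mulr_ge0// ltW.
by rewrite invr_ge0 mulr_ge0// ltW.
Qed.

Lemma hopf_lax_fin t x : (0 < t < 1)%R -> hopf_laxP t xi x \is a fin_num.
Proof.
move=> /andP[t0 t1].
have := @hopf_lax_half t x; have := @hopf_lax_ge t x.
rewrite t0 t1 (ltW t1) => /(_ isT) h1 /(_ isT) h2.
rewrite fin_numE -ltey -ltNye.
by rewrite (le_lt_trans h2) ?ltry// (lt_le_trans _ h1) ?ltNyr.
Qed.

(** For [t < 1] the denominators are at least [1 - t], so all competitors share
    one Lipschitz constant, which their infimum inherits. *)
Lemma hopf_lax_lipschitz t x x' : (0 < t < 1)%R ->
  hopf_laxP t xi x <=
  hopf_laxP t xi x' + ((t * (1 - t))^-1 * enorm (x - x'))%:E.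
Proof.
move=> /andP[t0 t1]; rewrite -leeBlDr//; apply: le_hopf_lax => // y xy.
have t1' : (0 < 1 - t)%R by rewrite subr_gt0.
have tt : (0 < t <= 1)%R by rewrite t0 ltW.
have C0 : (0 <= (t * (1 - t))^-1)%R by rewrite invr_ge0 mulr_ge0// ltW.
have e0 := enorm_ge0 (x - x').
rewrite leeBlDr//.
case E : (xi y) => [r| |]; last by have := xi_neqNy y; rewrite E.
  have u := denom_ge E (ltW t0).
  have u0 : (0 < 1 + 2 * t * r)%R by apply: lt_le_trans u.
  apply: (le_trans (hopf_lax_le_cap x tt E u0)).
  rewrite (hopf_lax_term_fin x' E) ?gt_eqF// -EFinD lee_fin.
  have := cos_cap_sqr_dist (enorm (x' - y)) (enorm (x - y)).
  rewrite cos_cap_lt// => h.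
  have dist : (`|enorm (x' - y) - enorm (x - y)| <= enorm (x - x'))%R.
    have h1 := enorm_triangle x' x y; have h2 := enorm_triangle x x' y.
    rewrite (enormB x' x) in h1.
    rewrite ler_norml; apply/andP; split; lra.
  set c := cos _ in h *; set c' := cos _ in h *.
  set v := (1 + 2 * t * r)%R in u u0 *.
  have h3 : (c ^+ 2 / v <= c' ^+ 2 / v + 2 * enorm (x - x') / (1 - t))%R.
    apply: (@le_trans _ _ (c' ^+ 2 / v + 2 * enorm (x - x') / v)%R).
      rewrite -mulrDl ler_pM2r ?invr_gt0//; lra.
    rewrite lerD2l ler_wpM2l ?mulr_ge0// lef_pV2 ?posrE//.
  have -> : ((t * (1 - t))^-1 * enorm (x - x') =
      (2 * t)^-1 * (2 * enorm (x - x') / (1 - t)) :> R)%R.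
    by field; rewrite !gt_eqF.
  rewrite -mulrDr ler_pM2l ?invr_gt0 ?mulr_gt0//; lra.
rewrite hopf_lax_term_y//; apply: (le_trans (hopf_lax_half x tt)).
by rewrite -EFinD lee_fin lerDl mulr_ge0.
Qed.

End LowerBound.
End HopfLax.

Section SemigroupInequality.
Context {R : realType} {d : nat}.
Local Notation V := 'rV[R]_d.
Implicit Types (x y z : V) (xi : V -> \bar R) (s t r : R).

(** In terms of [w = t * u / (t - s)] the factors on the right become
    [s / (t * (w - 1)) * (w - 1 + ca ^+ 2)] and [t / (s * w) * (w - cb ^+ 2)],
    whose product is compared with [cg ^+ 2] by [cone_triangle]. *)
Lemma cone_product s t u v ca cb cg (X : R) : 0 < s -> s < t -> 0 < u -> 0 < v ->
  s * v = t * u - (t - s) ->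
  cb ^+ 2 <= 1 ->
  (forall w, 1 <= w ->
    w * (w - 1) * cg ^+ 2 <= (w - 1 + ca ^+ 2) * (w - cb ^+ 2)) ->
  X <= (2 * t)^-1 * (1 - ca ^+ 2 / v) ->
  cg ^+ 2 <= (1 - 2 * (t - s) * X) *
    (1 + 2 * (t - s) * ((2 * s)^-1 * (1 - cb ^+ 2 / u))).
Proof.
move=> s0 st u0 v0 vE cb1 cone XE.
have t0 : 0 < t by apply: lt_trans st.
have ts0 : 0 < t - s by rewrite subr_gt0.
pose w := t * u / (t - s).
have wE : w - 1 = s * v / (t - s) by rewrite vE /w; field; rewrite gt_eqF.
have w1 : 0 < w - 1 by rewrite wE divr_gt0// mulr_gt0.
have w0 : 0 < w by lra.
have sN : s != 0 by rewrite gt_eqF.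
have tN : t != 0 by rewrite gt_eqF.
have uN : u != 0 by rewrite gt_eqF.
have vN : v != 0 by rewrite gt_eqF.
have tsN : t - s != 0 by rewrite gt_eqF.
have -> : 1 + 2 * (t - s) * ((2 * s)^-1 * (1 - cb ^+ 2 / u)) =
    t / (s * w) * (w - cb ^+ 2).
  by rewrite /w; field; rewrite ?sN ?tN ?uN ?tsN.
have A : s / (t * (w - 1)) * (w - 1 + ca ^+ 2) <= 1 - 2 * (t - s) * X.
  have -> : s / (t * (w - 1)) * (w - 1 + ca ^+ 2) =
      1 - 2 * (t - s) * ((2 * t)^-1 * (1 - ca ^+ 2 / v)).
    by rewrite wE; field; rewrite ?sN ?tN ?vN ?tsN.
  by rewrite lerD2l lerN2 ler_wpM2l// mulr_ge0// ltW.
apply: (@le_trans _ _ (s / (t * (w - 1)) * (w - 1 + ca ^+ 2) *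
                       (t / (s * w) * (w - cb ^+ 2)))); last first.
  rewrite ler_wpM2r// mulr_ge0//; last by lra.
  by apply: divr_ge0; [exact: ltW|apply: mulr_ge0; exact: ltW].
have -> : s / (t * (w - 1)) * (w - 1 + ca ^+ 2) * (t / (s * w) * (w - cb ^+ 2))
    = (w * (w - 1))^-1 * ((w - 1 + ca ^+ 2) * (w - cb ^+ 2)).
  by field; rewrite sN tN !gt_eqF.
have ww : 0 < w * (w - 1) by exact: mulr_gt0.
by rewrite ler_pdivlMl//; apply: cone; lra.
Qed.

Local Open Scope ereal_scope.

(** Up to solving for [hopf_laxP s xi y], this is the half
    [hopf_laxP t xi <= hopf_laxP (t - s) (hopf_laxP s xi)] of the semigroup
    property.  Every competitor [z] for [hopf_laxP s xi y] is also one for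
    [hopf_laxP t xi x], and the two values are compared along the triangle
    [x], [y], [z]. *)
Lemma hopf_lax_dual_constraint xi s t : (forall y, (- 2^-1)%:E <= xi y) ->
  (0 <= s)%R -> (s < t)%R -> (t <= 1)%R ->
  dual_constraint (t - s) (hopf_laxP s xi) (hopf_laxP t xi).
Proof.
move=> xi_ge s0 st t1 x y sy tx.
have t0 : (0 < t)%R by apply: le_lt_trans st.
have t01 : (0 < t <= 1)%R by rewrite t0.
have ts0 : (0 < t - s)%R by rewrite subr_gt0.
have Xhalf := hopf_lax_half xi_ge x t01.
case EX : (hopf_laxP t xi x) Xhalf tx => [X| |]// Xhalf _.
rewrite lee_fin in Xhalf.
rewrite -/(cap (enorm (x - y))).
set cg := cos (cap (enorm (x - y))).
have [sz|sN] := eqVneq s 0%R.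
  move: sy; rewrite sz subr0 /hopf_laxP eqxx.
  case E : (xi y) => [r| |]// _; last by have := xi_neqNy xi_ge y; rewrite E.
  rewrite [leRHS](_ : _ = ((1 - 2 * t * X) * (1 + 2 * t * r))%:E)// lee_fin.
  have := denom_ge xi_ge E (ltW t0); set u := (1 + 2 * t * r)%R => tu.
  have [uz|uN] := eqVneq u 0%R.
    rewrite uz mulr0 /cg.
    have [xy|xy] := ltP (enorm (x - y)) (pi / 2)%R.
      have := hopf_lax_le xi t0 xy.
      by rewrite (hopf_lax_term_Ny t0 E uz xy) EX.
    by rewrite cos_cap_ge// expr0n.
  have u0 : (0 < u)%R by rewrite lt_neqAle eq_sym uN (le_trans _ tu)// subr_ge0.
  have := hopf_lax_le_cap xi_ge x t01 E u0; rewrite EX lee_fin -/cg -/u => XE.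
  rewrite -ler_pdivrMr// -[leLHS](subKr 1%R) lerD2l lerN2.
  by rewrite mulrC -ler_pdivlMr ?mulr_gt0// mulrC.
have sp : (0 < s)%R by rewrite lt_neqAle eq_sym sN.
have s01 : (0 < s < 1)%R by rewrite sp (lt_le_trans st).
have := hopf_lax_fin xi_ge y s01; case EY : (hopf_laxP s xi y) => [Y| |]// _.
rewrite [leRHS](_ : _ =
  ((1 - 2 * (t - s) * X) * (1 + 2 * (t - s) * Y))%:E)// lee_fin.
set A := (1 - 2 * (t - s) * X)%R.
have A_ge : (s / t <= A)%R.
  have -> : (s / t = 1 - 2 * (t - s) * (2 * t)^-1)%R by field; rewrite gt_eqF.
  by rewrite lerD2l lerN2 ler_wpM2l// mulr_ge0// ltW.
have A0 : (0 < A)%R by apply: lt_le_trans A_ge; rewrite divr_gt0.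
suff : ((cg ^+ 2 / A - 1) / (2 * (t - s)))%:E <= hopf_laxP s xi y.
  rewrite EY lee_fin ler_pdivrMr ?mulr_gt0// lerBlDr ler_pdivrMr//.
  by rewrite addrC [(Y * _)%R]mulrC [leRHS]mulrC.
apply: le_hopf_lax => // z yz.
have cg1 : (cg ^+ 2 <= 1)%R := cos_sqr_le1 _.
case E : (xi z) => [r| |]; last by have := xi_neqNy xi_ge z; rewrite E.
  have us := denom_ge xi_ge E s0; have vt := denom_ge xi_ge E (ltW t0).
  have u0 : (0 < 1 + 2 * s * r)%R.
    by apply: lt_le_trans us; rewrite subr_gt0 (lt_le_trans st).
  rewrite (hopf_lax_term_fin y E) ?gt_eqF// lee_fin.
  rewrite ler_pdivrMr ?mulr_gt0// lerBlDr ler_pdivrMr// mulrC.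
  rewrite [(_ + 1)%R]addrC [(_ * (2 * _))%R]mulrC.
  have abg := enorm_triangle x y z.
  (* If the denominator vanishes then [xi z = - 2^-1] and [t = 1]; finiteness of
     [hopf_laxP t xi x] keeps [z] at distance at least [pi / 2] from [x]. *)
  have [vz|vN] := eqVneq (1 + 2 * t * r)%R 0%R.
    have [xz|xz] := ltP (enorm (x - z)) (pi / 2)%R.
      have := hopf_lax_le xi t0 xz.
      by rewrite (hopf_lax_term_Ny t0 E vz xz) EX.
    have uE : (1 + 2 * s * r = (t - s) / t)%R.
      have -> : (r = - (2 * t)^-1)%R.
        apply: (@mulfI _ (2 * t)%R); first by rewrite gt_eqF// mulr_gt0.
        by rewrite mulrN mulfV ?gt_eqF ?mulr_gt0//; lra.
      by field; rewrite !gt_eqF.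
    have -> : (1 + 2 * (t - s) * ((2 * s)^-1 *
        (1 - cos (enorm (y - z)) ^+ 2 / (1 + 2 * s * r))) =
        (s / t)^-1 * (1 - cos (enorm (y - z)) ^+ 2))%R.
      by rewrite uE; field; rewrite !gt_eqF.
    have e1 := enorm_ge0 (y - z); have e2 := enorm_ge0 (x - y).
    have cs : (cos (enorm (y - z)) <= sin (cap (enorm (x - y))))%R.
      apply: cos_le_sin; [exact: ltW|exact: cap_itv|].
      rewrite /cap.
      by have [h|h] := leP (enorm (x - y)) (pi / 2)%R; lra.
    have cb0 : (0 <= cos (enorm (y - z)))%R.
      by apply: cos_ge0_pihalf; have := @pihalf_gt0 R; lra.
    have : (cos (enorm (y - z)) ^+ 2 <= sin (cap (enorm (x - y))) ^+ 2)%R.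
      by rewrite ler_pXn2r// nnegrE (le_trans cb0).
    rewrite sin2cos2 -/cg => cg2.
    apply: (@le_trans _ _ (1 - cos (enorm (y - z)) ^+ 2)%R); first by lra.
    rewrite mulrA ler_peMl ?subr_ge0 ?cos_sqr_le1//.
    by rewrite ler_pdivlMr ?divr_gt0// mul1r.
  have v0 : (0 < 1 + 2 * t * r)%R.
    by rewrite lt_neqAle eq_sym vN (le_trans _ vt)// subr_ge0.
  have := hopf_lax_le_cap xi_ge x t01 E v0; rewrite EX lee_fin => XE.
  apply: (cone_product (v := (1 + 2 * t * r)%R) sp st u0 v0 _ _ _ XE).
  - by ring.
  - exact: cos_sqr_le1.
  - move=> w w1; apply: cone_triangle => //; rewrite ?enorm_ge0 ?(ltW yz)//.
    by rewrite [leRHS]addrC.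
rewrite hopf_lax_term_y// lee_fin.
rewrite ler_pdivrMr ?mulr_gt0// lerBlDr ler_pdivrMr//.
have -> : ((2 * s)^-1 * (2 * (t - s)) + 1 = t / s :> R)%R by field.
apply: (le_trans cg1); rewrite -ler_pdivrMl ?divr_gt0// mulr1 invf_div.
exact: A_ge.
Qed.

End SemigroupInequality.

(** * Regularity of Hopf-Lax evolutions and tight potentials *)

Section HopfLaxContinuity.
Context {R : realType} {d : nat}.
Local Notation V := 'rV[R]_d.
Local Notation T := (borelRd R d).
Local Notation fmeas := {finite_measure set T -> \bar R}.
Implicit Types (x y z : V) (xi : V -> \bar R) (s t r : R).

(** The neighbourhoods of ['rV[R]_d] are those of the sup norm, which is
    equivalent to the Euclidean one. *)
Lemma near_enorm x (e : R) : 0 < e -> \forall y \near x, enorm (x - y) < e.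
Proof.
move=> e0; pose b : R := e / d.+1%:R.
have b0 : 0 < b by rewrite divr_gt0.
near=> y.
have xy : ball x b y by near: y; exact: nbhsx_ballx.
have eE : e = d.+1%:R * b by rewrite mulrC divfK.
rewrite -(ltr_pXn2r (n := 2)) ?nnegrE ?enorm_ge0 ?(ltW e0)//.
rewrite sqr_sqrtr ?sum_sqr_ge0//.
apply: (@le_lt_trans _ _ (\sum_(i < d) b ^+ 2)).
  apply: ler_sum => i _; rewrite !mxE.
  case: xy => _ /(_ ord0 i); rewrite /ball/= => /ltW h.
  by rewrite -real_normK ?num_real// ler_pXn2r ?nnegrE// ltW.
have -> : \sum_(i < d) b ^+ 2 = d%:R * b ^+ 2.
  by rewrite sumr_const card_ord mulr_natl.
have -> : e ^+ 2 = d.+1%:R ^+ 2 * b ^+ 2 by rewrite -exprMn -eE.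
rewrite ltr_pM2r ?exprn_gt0//.
by rewrite -natrX ltr_nat -[X in (X <= _)%N]expn1 leq_pexp2l.
Unshelve. all: by end_near. Qed.

Lemma hopf_lax_continuous xi t : (forall y, (- 2^-1)%:E <= xi y)%E ->
  0 < t < 1 -> continuous (fun x => fine (hopf_laxP t xi x)).
Proof.
move=> xi_ge t01; have /andP[t0 t1] := t01.
have C0 : 0 < (t * (1 - t))^-1 by rewrite invr_gt0 mulr_gt0// subr_gt0.
set C := (t * (1 - t))^-1 in C0.
have lip u v : fine (hopf_laxP t xi u) <= fine (hopf_laxP t xi v) + C * enorm (u - v).
  have := hopf_lax_lipschitz xi_ge u v t01.
  rewrite -(fineK (hopf_lax_fin xi_ge u t01)) -(fineK (hopf_lax_fin xi_ge v t01)).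
  by rewrite -EFinD lee_fin.
have near_lip (x : V) e : 0 < e -> \forall y \near x,
    `|fine (hopf_laxP t xi x) - fine (hopf_laxP t xi y)| < e.
  move=> e0; near=> y.
  have xy : enorm (x - y) < e / C by near: y; apply: near_enorm; rewrite divr_gt0.
  have := lip x y; have := lip y x; rewrite (enormB y x) ltr_norml.
  move: xy; rewrite ltr_pdivlMr// => h1 h2 h3.
  by apply/andP; split; lra.
move=> x; apply/(@cvgrPdist_lt _ _ _ (nbhs (x : V)) _) => e e0.
exact: near_lip.
Unshelve. all: by end_near. Qed.

Lemma measurable_hopf_lax xi t : (forall y, (- 2^-1)%:E <= xi y)%E ->
  0 < t < 1 -> measurable_fun [set: T] (hopf_laxP t xi : T -> \bar R).
Proof.
move=> xi_ge t01.
have -> : hopf_laxP t xi = EFin \o (fun x => fine (hopf_laxP t xi x)).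
  by apply/funext => x /=; rewrite fineK// hopf_lax_fin.
apply/measurable_EFinP; apply: continuous_borel_measurable.
exact: hopf_lax_continuous.
Qed.

Lemma integrable_hopf_lax (mu : fmeas) xi t :
  (forall y, (- 2^-1)%:E <= xi y)%E -> 0 < t < 1 ->
  mu.-integrable [set: T] (hopf_laxP t xi).
Proof.
move=> xi_ge t01; have /andP[t0 t1] := t01.
pose C := Num.max (2 * t)^-1 (2 * (1 - t))^-1.
apply: (@le_integrable _ T R mu setT measurableT _ (EFin \o cst C)).
- exact: measurable_hopf_lax.
- move=> x _ /=.
  have h1 := hopf_lax_ge xi_ge x t01.
  have tt : 0 < t <= 1 by rewrite t0 ltW.
  have h2 := hopf_lax_half xi_ge x tt.
  rewrite -(fineK (hopf_lax_fin xi_ge x t01)) !lee_fin in h1 h2 *.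
  rewrite [leRHS]ger0_norm; last first.
    by rewrite le_max invr_ge0 mulr_ge0// ltW.
  have C1 : (2 * t)^-1 <= C by rewrite le_max lexx.
  have C2 : (2 * (1 - t))^-1 <= C by rewrite le_max lexx orbT.
  by rewrite ler_norml; apply/andP; split; lra.
- exact: finite_measure_integrable_cst.
Qed.

End HopfLaxContinuity.

Section TightPotentials.
Context {R : realType} {d : nat}.
Local Notation V := 'rV[R]_d.
Local Notation T := (borelRd R d).
Implicit Types (x y z : V) (phi psi : V -> \bar R).
Local Open Scope ereal_scope.

Lemma xi0_ge phi y : (- 2^-1)%:E <= xi0 phi y.
Proof.
rewrite /xi0; have := expeR_ge0 (2%:E * phi y).
case: (expeR _) => [r| |]// r0.
  by rewrite -EFinB -EFinM lee_fin; rewrite lee_fin in r0; lra.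
by rewrite addye// gt0_muley ?lte_fin ?invr_gt0// leey.
Qed.

Lemma oppe_bxi1 phi : \- bxi1 phi = xi0 (\- phi).
Proof.
apply/funext => x; rewrite /bxi1 /xi0 muleN.
have := expeR_ge0 (- (2%:E * phi x)).
case: (expeR _) => [r| |]// r0.
  by rewrite -EFinB -EFinM -EFinN -EFinB -EFinM; congr EFin; lra.
by rewrite addye// addeNy// gt0_muley ?lte_fin ?invr_gt0// gt0_muleNy ?lte_fin ?invr_gt0.
Qed.

Lemma oppe_xi0 phi : \- xi0 phi = bxi1 (\- phi).
Proof.
apply/funext => x.
have := congr1 (fun f : V -> \bar R => - f x) (oppe_bxi1 (\- phi)).
by rewrite /= oppeK => ->; rewrite /xi0 /= oppeK.
Qed.

Lemma bxi1_mono (u v : \bar R) :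
  (2^-1%:E * (1 - expeR (- (2%:E * u))) <=
   2^-1%:E * (1 - expeR (- (2%:E * v)))) = (u <= v).
Proof.
have h0 : (0 < 2^-1 :> R)%R by rewrite invr_gt0.
rewrite lee_pmul2l// leeD2lE// leeN2 lee_expeR leeN2 lee_pmul2l//.
Qed.

Lemma hopf_lax_term1 phi x y : (enorm (x - y) < pi / 2)%R ->
  hopf_lax_term 1 (xi0 phi) x y =
  2^-1%:E * (1 - expeR (- (2%:E * (phi y + L1 (x - y)%R)))).
Proof.
move=> xy; rewrite /L1 xy.
have c0 := cos_enorm_gt0 xy.
case E : (phi y) => [r| |].
- have E1 : xi0 phi y = (2^-1 * (expR (2 * r) - 1))%:E by rewrite /xi0 E.
  have E2 : (1 + 2 * 1 * (2^-1 * (expR (2 * r) - 1)) = expR (2 * r))%R by field.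
  have e0 := expR_gt0 (2 * r).
  rewrite (hopf_lax_term_fin x E1) E2 ?gt_eqF//.
  rewrite [RHS](_ : _ = (2^-1 *
    (1 - expR (- (2 * (r - ln (cos (enorm (x - y))))))))%:E)//.
  congr (_%:E); rewrite mulr1; congr (_ * (1 - _))%R.
  have -> : (- (2 * (r - ln (cos (enorm (x - y))))) =
     ln (cos (enorm (x - y))) *+ 2 - 2 * r)%R by ring.
  by rewrite expRD expRN -lnXn// lnK// posrE exprn_gt0.
- have E1 : xi0 phi y = +oo.
    by rewrite /xi0 E gt0_muley// gt0_muley// lte_fin invr_gt0.
  rewrite hopf_lax_term_y// mulr1.
  by rewrite addye// gt0_muley//= sube0 mule1.
have E1 : xi0 phi y = (- 2^-1)%:E.
  transitivity ((2^-1 * (0 - 1))%:E : \bar R); last by congr EFin; lra.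
  by rewrite /xi0 E gt0_muleNy.
rewrite (hopf_lax_term_Ny _ E1)//; last by field.
by rewrite addNye gt0_muleNy//= addeNy// gt0_muleNy// lte_fin invr_gt0.
Qed.

(** The map [z |-> 2^-1 * (1 - expR (- 2 * z))] is an increasing bijection from
    [[-oo, +oo]] onto [[-oo, 2^-1]], so it commutes with infima; it conjugates
    the infimal convolution with [L1] to [hopf_laxP 1]. *)
Lemma hopf_lax1 phi psi :
  (forall x, psi x = ereal_inf [set phi y + L1 (x - y)%R
     | y in [set y | enorm (y - x) < pi / 2]%R]) ->
  hopf_laxP 1 (xi0 phi) = bxi1 psi.
Proof.
move=> psiE; apply/funext => x; apply/eqP; rewrite eq_le; apply/andP; split.
  have [z zE] : exists z : \bar R, hopf_laxP 1 (xi0 phi) x =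
      2^-1%:E * (1 - expeR (- (2%:E * z))).
    have := @hopf_lax_half _ _ _ (xi0_ge phi) 1%R x.
    rewrite ltr01 lexx mulr1 => /(_ isT).
    case: (hopf_laxP _ _ _) => [r| |]//.
      rewrite lee_fin => r2.
      have [|w wE] := @expeR_total R (1 - 2 * r)%:E; first by rewrite lee_fin; lra.
      exists (- (2^-1%:E * w)).
      rewrite muleN oppeK muleA -EFinM divff// mul1e wE -EFinB -EFinM.
      by congr EFin; field.
    exists -oo.
    by rewrite gt0_muleNy//= addeNy// gt0_muleNy// lte_fin invr_gt0.
  rewrite zE bxi1_mono psiE; apply: le_ereal_inf_tmp => _ [y /= yx <-].
  rewrite enormB in yx.
  by rewrite -bxi1_mono -zE -hopf_lax_term1// hopf_lax_le.
apply: le_hopf_lax => // y xy; rewrite hopf_lax_term1// bxi1_mono psiE.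
by apply: ereal_inf_lbound; exists y => //=; rewrite enormB.
Qed.

End TightPotentials.

(** * Optimality along a geodesic and the contact set *)

Section GeodesicDuality.
Context {R : realType} {d : nat}.
Local Notation V := 'rV[R]_d.
Local Notation T := (borelRd R d).
Local Notation fmeas := {finite_measure set T -> \bar R}.
Implicit Types (x y z : V) (xi : V -> \bar R) (s t r : R).
Local Open Scope ereal_scope.

(** [weak_duality] for the pair [1 + 2 * tau * xs], [1 - 2 * tau * xt]. *)
Lemma dual_pair_le (mus mut : fmeas) (tau k : R) (xs xt : V -> \bar R) :
  (0 < tau)%R -> dual_constraint tau xs xt ->
  (forall x, (- (2 * tau)^-1)%:E <= xs x) ->
  (forall x, xt x <= ((2 * tau)^-1)%:E) ->
  mus.-integrable [set: T] xs -> mut.-integrable [set: T] xt ->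
  HK mus mut ^+ 2 = k%:E ->
  (2 * tau * (fine (\int[mut]_x xt x) - fine (\int[mus]_x xs x)) <= k)%R.
Proof.
move=> tau0 cons xs_ge xt_le is_ it_ HKE.
have tau2 : (0 < 2 * tau)%R by rewrite mulr_gt0.
have i1 (mu : fmeas) : mu.-integrable [set: T] (EFin \o cst 1%R).
  exact: finite_measure_integrable_cst.
have ia := integrableD measurableT (i1 mus) (integrableZl measurableT (2 * tau)%R is_).
have ib := integrableB measurableT (i1 mut) (integrableZl measurableT (2 * tau)%R it_).
pose a : T -> \bar R := fun x => 1 + (2 * tau)%:E * xs x.
pose b : T -> \bar R := fun x => 1 - (2 * tau)%:E * xt x.
have a0 x : 0 <= a x.
  have := xs_ge x; rewrite /a; case: (xs x) => [r| |]//.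
    rewrite lee_fin => h; rewrite -EFinM -EFinD lee_fin.
    have : (2 * tau * - (2 * tau)^-1 <= 2 * tau * r)%R by rewrite ler_pM2l.
    by rewrite mulrN divff ?gt_eqF//; lra.
  by rewrite gt0_muley// addey.
have b0 x : 0 <= b x.
  have := xt_le x; rewrite /b; case: (xt x) => [r| |]//.
    rewrite lee_fin => h; rewrite -EFinM -EFinB lee_fin.
    have : (2 * tau * r <= 2 * tau * (2 * tau)^-1)%R by rewrite ler_pM2l.
    by rewrite divff ?gt_eqF//; lra.
  by rewrite gt0_muleNy//= leey.
have := @weak_duality R d mus mut a b.
rewrite HKE.
have aE : \int[mus]_x a x = mus setT + (2 * tau)%:E * \int[mus]_x xs x.
  rewrite integralD//=; last exact: integrableZl.
  by rewrite integral_cst// mul1e integralZl.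
have bE : \int[mut]_x b x = mut setT - (2 * tau)%:E * \int[mut]_x xt x.
  rewrite integralB//=; last exact: integrableZl.
  by rewrite integral_cst// mul1e integralZl.
have fs := integrable_fin_num measurableT is_.
have ft := integrable_fin_num measurableT it_.
have Ms := fin_finite_measure mus; have Mt := fin_finite_measure mut.
rewrite aE bE -(fineK fs) -(fineK ft) -(fineK Ms) -(fineK Mt).
move: (fine (\int[mus]_x xs x)) (fine (\int[mut]_x xt x)) (fine (mus setT))
  (fine (mut setT)) => i j p q H /=.
suff : (p + q <= p + 2 * tau * i + (q - 2 * tau * j) + k)%R by lra.
rewrite -lee_fin; apply: H => //.
- exact: measurable_int ia.
- exact: measurable_int ib.
- exact: (ltry (p + 2 * tau * i)).
- exact: (ltry (q - 2 * tau * j)).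
- move=> x y ax bx.
  rewrite enormB muleC; apply: cons.
    by move: ax; rewrite /a; case: (xs x) => [r _||]//; rewrite ?ltry ?gt0_muley.
  by move: bx; rewrite /b; case: (xt y) => [r _||]//; rewrite ?ltNyr ?gt0_muleNy.
Qed.

Variables (nu : R -> fmeas) (xi : V -> \bar R) (k : R).
Hypothesis xi_ge : forall y, (- 2^-1)%:E <= xi y.
Hypothesis HKk : forall s t, (0 <= s <= 1)%R -> (0 <= t <= 1)%R ->
  HK (nu s) (nu t) ^+ 2 = ((t - s) ^+ 2 * k)%:E.
Hypothesis int0 : (nu 0%R).-integrable [set: T] xi.
Hypothesis int1 : (nu 1%R).-integrable [set: T] (hopf_laxP 1 xi).
Hypothesis opt : \int[nu 1%R]_x hopf_laxP 1 xi x - \int[nu 0%R]_x xi x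
  = (2^-1 * k)%:E.

Let I t := fine (\int[nu t]_x hopf_laxP t xi x).

Lemma integrable_family t : (0 <= t <= 1)%R ->
  (nu t).-integrable [set: T] (hopf_laxP t xi).
Proof.
move=> /andP[t0 t1].
have [->|tN0] := eqVneq t 0%R.
  by rewrite (_ : hopf_laxP 0 xi = xi)//; apply/funext => x; rewrite /hopf_laxP eqxx.
have [->//|tN1] := eqVneq t 1%R.
by apply: integrable_hopf_lax => //; rewrite !lt_neqAle eq_sym tN0 t0 tN1.
Qed.

Lemma family_step s t : (0 <= s)%R -> (s <= t)%R -> (t <= 1)%R ->
  (I t - I s <= 2^-1 * ((t - s) * k))%R.
Proof.
move=> s0; rewrite le_eqVlt => /predU1P[<- _|st t1]; first by rewrite !subrr mul0r mulr0.
have t0 : (0 < t)%R by apply: le_lt_trans st.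
have s1 : (s < 1)%R by apply: lt_le_trans t1.
have ts : (0 < t - s)%R by rewrite subr_gt0.
have H : (2 * (t - s) * (I t - I s) <= (t - s) ^+ 2 * k)%R.
  apply: (@dual_pair_le (nu s) (nu t) (t - s) _ (hopf_laxP s xi) (hopf_laxP t xi)).
  - by [].
  - exact: hopf_lax_dual_constraint.
  - move=> x; apply: (@le_trans _ _ (- (2 * (1 - s))^-1)%:E).
      rewrite lee_fin lerN2 lef_pV2 ?posrE ?mulr_gt0//; lra.
    have [sz|sN] := eqVneq s 0%R.
      by rewrite sz /hopf_laxP eqxx subr0 mulr1.
    by apply: hopf_lax_ge => //; rewrite lt_neqAle eq_sym sN s0.
  - move=> x; apply: (@le_trans _ _ ((2 * t)^-1)%:E).
      by apply: hopf_lax_half => //; rewrite t0.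
    rewrite lee_fin lef_pV2 ?posrE ?mulr_gt0//; lra.
  - by apply: integrable_family; rewrite s0 ltW.
  - by apply: integrable_family; rewrite t1 ltW.
  - by apply: HKk; rewrite ?s0 ?t1 ltW.
rewrite -(ler_pM2l (mulr_gt0 (ltr0n R 2) ts)).
apply: (le_trans H); rewrite le_eqVlt; apply/orP; left; by apply/eqP; field.
Qed.

Lemma family_total : (I 1 - I 0 = 2^-1 * k)%R.
Proof.
have i0 : (0 <= (0 : R) <= 1)%R by rewrite lexx ler01.
have f0 := integrable_fin_num measurableT (integrable_family i0).
have f1 := integrable_fin_num measurableT int1.
have E0 : hopf_laxP 0 xi = xi by apply/funext => x; rewrite /hopf_laxP eqxx.
move: opt; rewrite -[in X in _ - X]E0 -(fineK f0) -(fineK f1) -EFinB.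
by move=> [].
Qed.

(** The three increments over [[0, s]], [[s, t]] and [[t, 1]] are bounded by
    [family_step], and the bounds add up to the value of the total increment. *)
Lemma family_eq s t : (0 <= s)%R -> (s <= t)%R -> (t <= 1)%R ->
  (I t - I s = 2^-1 * ((t - s) * k))%R.
Proof.
move=> s0 st t1.
have h1 := family_step s0 st t1.
have h2 := family_step (lexx 0%R) s0 (le_trans st t1).
have h3 := family_step (le_trans s0 st) t1 (lexx 1%R).
have h4 := family_total.
have e2 : (2^-1 * ((s - 0) * k) = 2^-1 * (s * k))%R by rewrite subr0.
have e3 : (2^-1 * ((1 - t) * k) = 2^-1 * k - 2^-1 * (t * k))%R by ring.
have e1 : (2^-1 * ((t - s) * k) = 2^-1 * (t * k) - 2^-1 * (s * k))%R by ring.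
by apply/le_anti/andP; split; lra.
Qed.

Lemma family_optimal s t : (0 <= s)%R -> (s < t)%R -> (t <= 1)%R ->
  (2 * (t - s))^-1%:E * HK (nu s) (nu t) ^+ 2 =
  \int[nu t]_x hopf_laxP t xi x - \int[nu s]_x hopf_laxP s xi x.
Proof.
move=> s0 st t1.
have t01 : (0 <= t <= 1)%R by rewrite t1 (le_trans s0)// ltW.
have s01 : (0 <= s <= 1)%R by rewrite s0 (le_trans (ltW st)).
have ft := integrable_fin_num measurableT (integrable_family t01).
have fs := integrable_fin_num measurableT (integrable_family s01).
rewrite -(fineK ft) -(fineK fs) -EFinB -/(I t) -/(I s) family_eq// ?ltW//.
rewrite HKk// -EFinM; congr EFin; field.
by rewrite subr_eq0 gt_eqF.
Qed.

End GeodesicDuality.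

Section ContactSet.
Context {R : realType} {d : nat}.
Local Notation V := 'rV[R]_d.
Local Notation T := (borelRd R d).
Local Notation fmeas := {finite_measure set T -> \bar R}.
Implicit Types (x y z : V) (xi : V -> \bar R) (s t r : R).
Local Open Scope ereal_scope.

(** This is [hopf_lax_dual_constraint] between the times [t] and [1], solved for
    the value at time [t] and optimized over the other point. *)
Lemma hopf_lax_backward_le xi xi' t x :
  (forall y, (- 2^-1)%:E <= xi y) -> (forall y, (- 2^-1)%:E <= xi' y) ->
  hopf_laxP 1 xi = \- xi' -> (0 < t < 1)%R ->
  - hopf_laxP t xi x <= hopf_laxP (1 - t) xi' x.
Proof.
move=> xi_ge xi'_ge E1 t01; have /andP[t0 t1] := t01.
have ts : (0 < 1 - t)%R by rewrite subr_gt0.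
have Xge := hopf_lax_ge xi_ge x t01.
have C := hopf_lax_dual_constraint xi_ge (ltW t0) t1 (lexx 1%R).
have Xf := hopf_lax_fin xi_ge x t01.
case EX : (hopf_laxP t xi x) Xf Xge => [X| |]// _; rewrite lee_fin => Xge.
apply: le_hopf_lax => // y xy.
have yge := xi'_ge y.
case E : (xi' y) yge => [r| |]//; rewrite ?lee_fin => yge.
  have u0 : (0 < 1 + 2 * (1 - t) * r)%R by nra.
  rewrite (hopf_lax_term_fin x E) ?gt_eqF// lee_fin.
  have := C y x; rewrite EX E1 /= E ltry ltNyr => /(_ isT isT).
  rewrite -/(cap _) enormB cos_cap_lt//.
  rewrite [leRHS](_ : _ = ((1 - 2 * (1 - t) * - r) *
    (1 + 2 * (1 - t) * X))%:E)// lee_fin => h.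
  rewrite ler_pdivlMl ?mulr_gt0// lerBrDr -lerBrDl ler_pdivrMr//.
  by rewrite mulrC; lra.
rewrite hopf_lax_term_y// lee_fin; lra.
Qed.

Lemma supp_zero_integral (mu : fmeas) (h : V -> R) : continuous h ->
  (forall x, 0 <= h x)%R -> \int[mu]_x (h x)%:E = 0 ->
  supp mu `<=` [set x | h x = 0%R].
Proof.
move=> ch h0 ih x xs; apply/eqP; apply: contraT => hx.
have hp : (0 < h x)%R by rewrite lt_neqAle eq_sym hx h0.
pose a := (h x / 2)%R.
have a0 : (0 < a)%R by rewrite divr_gt0.
have mh : measurable_fun [set: T] (EFin \o h : T -> \bar R).
  by apply/measurable_EFinP; exact: continuous_borel_measurable.
pose U : set V := [set y | (a < h y)%R].
have oU : open U.
  apply: (@open_comp _ _ h [set r | (a < r)%R]); last exact: open_gt.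
  by move=> ? _; exact: ch.
have Ux : U x by rewrite /U/= /a; lra.
have := xs U oU Ux.
have mU : measurable (U : set T) by exact: sub_sigma_algebra.
have : a%:E * mu U <= 0.
  rewrite -integral_cst// -ih.
  apply: (@le_trans _ _ (\int[mu]_(y in U) (h y)%:E)).
    apply: ge0_le_integral => //.
    - by move=> y _; rewrite lee_fin ltW.
    - exact: measurable_funTS.
    - by move=> y Uy; rewrite lee_fin ltW.
  by apply: ge0_subset_integral => // y _; rewrite lee_fin.
by rewrite pmule_rle0 ?lte_fin// => /le_lt_trans /[apply]; rewrite ltxx.
Qed.

End ContactSet.

Section Integrability.
Context {R : realType} {d : nat}.
Local Notation V := 'rV[R]_d.
Local Notation T := (borelRd R d).
Local Notation fmeas := {finite_measure set T -> \bar R}.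
Implicit Types (x y z : V) (xi : V -> \bar R) (s t r : R).
Local Open Scope ereal_scope.

Lemma L1N (z : V) : L1 (- z)%R = L1 z.
Proof. by rewrite /L1 enormN. Qed.

(** The preimage of a ray under an increasing map onto [[0, +oo]] is a ray, or
    everything if the ray contains [[0, +oo]]. *)
Lemma measurable_expeR : measurable_fun [set: \bar R] (@expeR R).
Proof.
apply: (measurability _ (ErealGenOInfty.measurableE R)).
move=> /= _ [_ [a ->]] <-; rewrite setTI.
have [a0|a0] := ltP a 0%R.
  rewrite (_ : _ @^-1` _ = setT)//; apply/seteqP; split => // z _ /=.
  by rewrite in_itv/= andbT (lt_le_trans _ (expeR_ge0 z)) ?lte_fin.
have [|b bE] := @expeR_total R a%:E; first by rewrite lee_fin.
rewrite (_ : _ @^-1` _ = [set` `]b, +oo[ ]); first exact: emeasurable_itv.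
by apply/seteqP; split => z /=; rewrite !in_itv/= !andbT -bE lte_expeR.
Qed.

(** Measures that agree on the Borel sets need not be equal as functions on all
    sets, so the end points of a geodesic joining [mu0] to [mu1] are [mu0] and
    [mu1] only in this weaker sense. *)
Lemma HK_ext (mu0 mu1 mu0' mu1' : fmeas) :
  (forall A : set T, measurable A -> mu0 A = mu0' A) ->
  (forall A : set T, measurable A -> mu1 A = mu1' A) ->
  HK mu0 mu1 = HK mu0' mu1'.
Proof.
move=> E0 E1.
have I0 (D : set T) f : measurable D -> \int[mu0]_(x in D) f x = \int[mu0']_(x in D) f x.
  by move=> mD; apply: eq_measure_integral => A mA _; exact: E0.
have I1 (D : set T) f : measurable D -> \int[mu1]_(x in D) f x = \int[mu1']_(x in D) f x.
  by move=> mD; apply: eq_measure_integral => A mA _; exact: E1.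
congr (sqrte (ereal_inf _)); apply/seteqP; split => _ [eta [s0 [s1 [[m s m0 m1] ->]]]];
  exists eta, s0, s1; (split; last by rewrite /HK_cost I0 ?I1);
  split => // A mA; by [rewrite m0// I0|rewrite m1// I1].
Qed.

Lemma xi0_integrable (mu : fmeas) (phi : V -> \bar R) :
  measurable_fun [set: T] (phi : T -> \bar R) ->
  \int[mu]_x expeR (2%:E * phi x) < +oo ->
  mu.-integrable [set: T] (xi0 phi).
Proof.
move=> mphi fin; rewrite /xi0; apply: integrableZl => //.
apply: integrableB => //; last exact: finite_measure_integrable_cst.
apply/integrableP; split.
  apply: measurableT_comp; first exact: measurable_expeR.
  exact: measurable_funeM.
by under eq_integral do rewrite gee0_abs ?expeR_ge0//.
Qed.

End Integrability.

Section TightPair.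
Context {R : realType} {d : nat}.
Local Notation V := 'rV[R]_d.
Local Notation T := (borelRd R d).
Local Notation fmeas := {finite_measure set T -> \bar R}.
Implicit Types (x y z : V) (xi : V -> \bar R) (s t r : R).
Local Open Scope ereal_scope.

Lemma integralN_integrable (mu : fmeas) (f : T -> \bar R) :
  mu.-integrable [set: T] f -> \int[mu]_x (- f x) = - \int[mu]_x f x.
Proof.
move=> fi; transitivity (\int[mu]_x ((-1)%:E * f x)).
  by apply: eq_integral => x _; rewrite EFinN mulN1e.
by rewrite integralZl// EFinN mulN1e.
Qed.

Variables (mu0 mu1 : fmeas) (phi0 phi1 : V -> \bar R).
Hypothesis tight : tight_optimal_pair mu0 mu1 phi0 phi1.

Lemma tight_forward : hopf_laxP 1 (xi0 phi0) = bxi1 phi1.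
Proof. exact/hopf_lax1/(tight_inf tight). Qed.

(** The supremum condition on [phi0] is the infimum condition for the pair
    [\- phi1], [\- phi0]. *)
Lemma tight_backward : hopf_laxP 1 (\- bxi1 phi1) = \- xi0 phi0.
Proof.
rewrite oppe_bxi1 oppe_xi0; apply: hopf_lax1 => x.
rewrite (tight_sup tight) -ereal_infN image_comp; congr ereal_inf.
apply: eq_imagel => y /= yx.
have Lfin : L1 (y - x)%R \is a fin_num by rewrite /L1 yx.
by rewrite fin_num_oppeD ?fin_numN// oppeK -L1N opprB.
Qed.

Lemma bxi1_integrable : mu1.-integrable [set: T] (\- bxi1 phi1).
Proof.
rewrite oppe_bxi1; apply: xi0_integrable.
  apply: measurableT_comp => //.
  exact: usc_borel_measurable (tight_usc tight).
have := tight_fin1 tight; congr (_ < _).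
by apply: eq_integral => x _; rewrite muleN.
Qed.

End TightPair.

Theorem theorem5p1 (R : realType) (d : nat)
    (mu0 mu1 : {finite_measure set (borelRd R d) -> \bar R})
    (phi0 phi1 : 'rV[R]_d -> \bar R)
    (mu : R -> {finite_measure set (borelRd R d) -> \bar R}) :
  tight_optimal_pair mu0 mu1 phi0 phi1 ->
  HK_geodesic mu ->
  connects mu mu0 mu1 ->
  (forall s t : R, 0 <= s <= 1 -> 0 <= t <= 1 -> s < t ->
     optimal_dual_pair (t - s) (mu s) (mu t) (xi_ phi0 s) (xi_ phi0 t) /\
     optimal_dual_pair (t - s) (mu s) (mu t) (bxi_ phi1 s) (bxi_ phi1 t)) /\
  (forall t : R, 0 <= t <= 1 -> supp (mu t) `<=` contact_set phi0 phi1 t).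
Proof.
move=> tight geo conn.
pose xi := xi0 phi0.
pose xi' : 'rV[R]_d -> \bar R := (\- bxi1 phi1)%E.
have xi_ge y : ((- 2^-1)%:E <= xi y)%E by exact: xi0_ge.
have xi'E : xi' = xi0 (\- phi1)%E by exact: oppe_bxi1.
have xi'_ge y : ((- 2^-1)%:E <= xi' y)%E 
  by rewrite xi'E; exact: xi0_ge.
have fwd : hopf_laxP 1 xi = bxi1 phi1 := tight_forward tight.
have bwd : hopf_laxP 1 xi' = (\- xi)%E := tight_backward tight.
have P0 (f : 'rV[R]_d -> \bar R) : hopf_laxP 0 f = f.
  by apply/funext => x; rewrite /hopf_laxP eqxx.
have muE0 A : measurable A -> mu 0 A = mu0 A by move=> /conn[].
have muE1 A : measurable A -> mu 1 A = mu1 A by move=> /conn[].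
have int0E f : (\int[mu0]_x f x = \int[mu 0%R]_x f x)%E.
  by apply/esym/eq_measure_integral => A mA _; exact: muE0.
have int1E f : (\int[mu1]_x f x = \int[mu 1%R]_x f x)%E.
  by apply/esym/eq_measure_integral => A mA _; exact: muE1.
have i0 : (mu 0%R).-integrable [set: borelRd R d] xi.
  apply: xi0_integrable; first exact: lsc_borel_measurable (tight_lsc tight).
  by rewrite -int0E; exact: tight_fin0 tight.
have i1' : (mu 1%R).-integrable [set: borelRd R d] xi'.
  have [m fin] := integrableP _ _ _ (bxi1_integrable tight).
  by apply/integrableP; split => //; rewrite -int1E.
have i1 : (mu 1%R).-integrable [set: borelRd R d] (bxi1 phi1).
  have := integrableN i1'; congr (integrable _ _ _).
  by apply/funext => x; rewrite /= oppeK.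
have i0' : (mu 0%R).-integrable [set: borelRd R d] (\- xi)%E by exact: integrableN.
(* The squared distance is a difference of finite integrals. *)
have opt : (2^-1%:E * HK (mu 0%R) (mu 1%R) ^+ 2 =
    \int[mu 1%R]_x bxi1 phi1 x - \int[mu 0%R]_x xi x)%E.
  by rewrite (HK_ext muE0 muE1) (tight_optimal tight) int0E int1E.
have f0 := integrable_fin_num measurableT i0.
have f1 := integrable_fin_num measurableT i1.
have [h HKh] : exists h : R, HK (mu 0%R) (mu 1%R) = h%:E.
  move: opt; rewrite -(fineK f0) -(fineK f1).
  have : (0 <= HK (mu 0%R) (mu 1%R))%E by exact: sqrte_ge0.
  case: (HK _ _) => [h| |]// _; first by exists h.
  by rewrite expe2 mulyy gt0_muley// lte_fin invr_gt0.
pose k := h ^+ 2.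
have HKk (s t : R) : 0 <= s <= 1 -> 0 <= t <= 1 ->
    (HK (mu s) (mu t) ^+ 2 = ((t - s) ^+ 2 * k)%:E)%E.
  move=> s01 t01; rewrite geo// HKh -EFinM expe2 -EFinM -expr2 exprMn.
  by rewrite real_normK ?num_real// -sqrrN opprB.
have optk : (\int[mu 1%R]_x bxi1 phi1 x - \int[mu 0%R]_x xi x = (2^-1 * k)%:E)%E.
  by rewrite -opt HKh expe2 /k expr2 !EFinM.
have rev01 (t : R) : 0 <= t <= 1 -> 0 <= 1 - t <= 1.
  by move=> /andP[t0 t1]; apply/andP; split; lra.
(* Reversing time turns [bxi_ phi1] into minus a forward Hopf-Lax family, the one
   started from [xi']; both families thus obey [family_optimal]. *)
pose nu t := mu (1 - t).
have HKk' (s t : R) : 0 <= s <= 1 -> 0 <= t <= 1 ->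
    (HK (nu s) (nu t) ^+ 2 = ((t - s) ^+ 2 * k)%:E)%E.
  move=> s01 t01; rewrite HKk ?rev01//; congr (_ * _)%:E.
  by ring.
have nu0 : nu 0 = mu 1 by rewrite /nu subr0.
have nu1 : nu 1 = mu 0 by rewrite /nu subrr.
have int1 : (mu 1%R).-integrable [set: borelRd R d] (hopf_laxP 1 xi) by rewrite fwd.
have opt1 : (\int[mu 1%R]_x hopf_laxP 1 xi x - \int[mu 0%R]_x xi x = (2^-1 * k)%:E)%E.
  by rewrite fwd.
have int0' : (nu 0%R).-integrable [set: borelRd R d] xi' by rewrite nu0.
have int1' : (nu 1%R).-integrable [set: borelRd R d] (hopf_laxP 1 xi') by rewrite nu1 bwd.
have opt1' : (\int[nu 1%R]_x hopf_laxP 1 xi' x - \int[nu 0%R]_x xi' x = (2^-1 * k)%:E)%E.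
  rewrite nu0 nu1 bwd -optk !integralN_integrable// oppeK.
  by rewrite addeC.
have fam (t : R) : 0 <= t <= 1 -> (mu t).-integrable [set: borelRd R d] (hopf_laxP t xi).
  by move=> t01; exact: (integrable_family xi_ge i0 int1 t01).
have fam' (t : R) : 0 <= t <= 1 ->
    (mu t).-integrable [set: borelRd R d] (hopf_laxP (1 - t) xi').
  move=> t01; have := integrable_family xi'_ge int0' int1' (rev01 _ t01).
  by rewrite /nu opprB addrC subrK.
have optim (s t : R) : 0 <= s -> s < t -> t <= 1 ->
    ((2 * (t - s))^-1%:E * HK (mu s) (mu t) ^+ 2 =
     \int[mu t]_x hopf_laxP t xi x - \int[mu s]_x hopf_laxP s xi x)%E.
  by move=> s0 st t1; exact: (family_optimal xi_ge HKk i0 int1 opt1 s0 st t1).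
have optim' (s t : R) : 0 <= s -> s < t -> t <= 1 ->
    ((2 * (t - s))^-1%:E * HK (mu s) (mu t) ^+ 2 =
     \int[mu s]_x hopf_laxP (1 - s) xi' x - \int[mu t]_x hopf_laxP (1 - t) xi' x)%E.
  move=> s0 st t1.
  have a : 0 <= 1 - t by lra.
  have b : 1 - t < 1 - s by lra.
  have c : 1 - s <= 1 by lra.
  have := family_optimal xi'_ge HKk' int0' int1' opt1' a b c.
  rewrite HKk' ?HKk; [|apply/andP; split; lra..].
  have -> : 1 - s - (1 - t) = t - s by ring.
  rewrite /nu.
  by rewrite !subKr.
split.
  move=> s t /andP[s0 s1] /andP[t0 t1] st; split; split.
  - exact: hopf_lax_dual_constraint.
  - exact: optim.
  - move=> x y ys xt.
    have C : dual_constraint (1 - s - (1 - t)) (hopf_laxP (1 - t) xi')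
        (hopf_laxP (1 - s) xi').
      by apply: hopf_lax_dual_constraint => //; lra.
    have := C y x; have -> : 1 - s - (1 - t) = t - s by ring.
    rewrite /bxi_ /hopf_laxR/= -/xi' in ys xt *.
    rewrite !muleN oppeK muleC enormB; apply.
      by rewrite -lteN2.
    by rewrite -lteN2.
  - rewrite optim'// !integralN_integrable; last 2 first.
    + by apply: fam'; rewrite s0.
    + by apply: fam'; rewrite t0.
    by rewrite oppeK addeC.
move=> t /andP[t0 t1].
have [->|tN0] := eqVneq t 0.
  move=> x _; rewrite /contact_set/= /xi_ /bxi_ /hopf_laxR subr0 P0.
  by rewrite -/xi' bwd oppeK.
have [->|tN1] := eqVneq t 1.
  move=> x _; rewrite /contact_set/= /xi_ /bxi_ /hopf_laxR subrr P0.
  by rewrite -/xi fwd oppeK.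
have t01 : 0 < t < 1 by rewrite !lt_neqAle eq_sym tN0 t0 tN1.
have t01' : 0 < 1 - t < 1 by apply/andP; split; lra.
pose g x := fine (hopf_laxP t xi x); pose g' x := fine (hopf_laxP (1 - t) xi' x).
have gE x : hopf_laxP t xi x = (g x)%:E by rewrite fineK// hopf_lax_fin.
have gE' x : hopf_laxP (1 - t) xi' x = (g' x)%:E by rewrite fineK// hopf_lax_fin.
have fwd' : hopf_laxP 1 xi = (\- xi')%E.
  by rewrite fwd; apply/funext => x; rewrite /xi' /= oppeK.
have tp : 0 < t by have /andP[] := t01.
have it : (mu t).-integrable [set: borelRd R d] (fun x => (g x)%:E).
  have := fam t; rewrite t0 t1 => /(_ isT); congr (integrable _ _ _).
  by apply/funext => x; rewrite gE.
have it' : (mu t).-integrable [set: borelRd R d] (fun x => (g' x)%:E).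
  have := fam' t; rewrite t0 t1 => /(_ isT); congr (integrable _ _ _).
  by apply/funext => x; rewrite gE'.
(* Both families have the increment [2^-1 * t * k] over [[0, t]] and the same
   integral at time [0]. *)
have sum0 : (\int[mu t]_x (g x + g' x)%:E = 0)%E.
  under eq_integral do rewrite EFinD.
  rewrite integralD//.
  have := optim' 0 t (lexx 0) tp t1; rewrite (optim 0 t (lexx 0) tp t1).
  rewrite P0 subr0 bwd integralN_integrable//.
  have -> : (\int[mu t]_x hopf_laxP t xi x = \int[mu t]_x (g x)%:E)%E.
    by apply: eq_integral => x _; rewrite gE.
  have -> : (\int[mu t]_x hopf_laxP (1 - t) xi' x = \int[mu t]_x (g' x)%:E)%E.
    by apply: eq_integral => x _; rewrite gE'.
  have fi := integrable_fin_num measurableT it.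
  have fi' := integrable_fin_num measurableT it'.
  rewrite -(fineK fi) -(fineK fi') -(fineK f0).
  by move=> [] E; rewrite -EFinD; congr EFin; lra.
move=> x xs.
have : g x + g' x = 0.
  apply: (@supp_zero_integral R d (mu t) (fun x => g x + g' x) _ _ sum0 x xs).
  - have cg : continuous g by exact: hopf_lax_continuous.
    have cg' : continuous g' by exact: hopf_lax_continuous.
    by move=> y; exact: (@continuousD _ _ _ g g' y (cg y) (cg' y)).
  - move=> y; have := hopf_lax_backward_le y xi_ge xi'_ge fwd' t01.
    by rewrite gE gE' -EFinN lee_fin; lra.
rewrite /contact_set/= /xi_ /bxi_ /hopf_laxR -/xi -/xi' gE gE' => h0.
by rewrite -EFinN; congr EFin; lra.
Qed.
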